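(* Let $r>0$ and let $\mathcal{B}_r=\{\varphi_{(r,h)}:h\in\mathbb{S}^3\}\simeq\mathbb{RP}^3$ be the isometric class of $\mathrm{Sp}(2)$-invariant $\mathrm{G}_2$-structures on $\mathbb{S}^7=\mathrm{Sp}(2)/\mathrm{Sp}(1)$ inducing $g_r$. Let $\mathbb{RP}^2=\{[(h_0,h_1,0,h_3)]\}$ and $\mathrm{NS}=[(0,0,\pm1,0)]$. The critical points of the reduced energy $E^{\mathrm{red}}$ on $\mathcal{B}_r$ have the following reduced index and reduced nullity: (1) for $r<1$: points of $\{r\}\times\mathrm{NS}$ have reduced index $0$ and reduced nullity $0$ (stable: local minima); points of $\{r\}\times\mathbb{RP}^2$ have reduced index $1$ and reduced nullity $2$ (unstable); (2) for $r>1$: points of $\{r\}\times\mathrm{NS}$ have reduced index $3$ and reduced nullity $0$ (unstable); points of $\{r\}\times\mathbb{RP}^2$ have reduced index $0$ and reduced nullity $2$ (stable: local minima). Finally, when $r=1$, $E^{\mathrm{red}}$ is constant on $\mathcal{B}_1$, so all of its points are trivially stable.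
   Context: $\mathrm{Sp}(1)\subset\mathrm{Sp}(2)$ via $h\mapsto\mathrm{diag}(h,1)$; $\mathbb{S}^7=\mathrm{Sp}(2)/\mathrm{Sp}(1)$; $\mathfrak{p}=\mathfrak{sp}(1)^\perp\simeq T_o\mathbb{S}^7$ has basis $e_1=\mathrm{diag}(0,i)$, $e_2=\mathrm{diag}(0,j)$, $e_3=\mathrm{diag}(0,k)$, $e_4=\frac1{\sqrt2}\begin{pmatrix}0&i\\ i&0\end{pmatrix}$, $e_5=\frac1{\sqrt2}\begin{pmatrix}0&j\\ j&0\end{pmatrix}$, $e_6=\frac1{\sqrt2}\begin{pmatrix}0&k\\ k&0\end{pmatrix}$, $e_7=\frac1{\sqrt2}\begin{pmatrix}0&1\\-1&0\end{pmatrix}$, dual basis $e^i$; $\mathfrak{p}_l=\mathrm{span}(e_l)$, $l=1,2,3$; $\omega_1=e^{47}+e^{56}$, $\omega_2=e^{46}-e^{57}$, $\omega_3=e^{45}+e^{67}$. Invariant tensors on $\mathbb{S}^7$ are identified with $\mathrm{Ad}(\mathrm{Sp}(1))$-invariant tensors on $\mathfrak{p}$, and for invariant $1$-forms $d\alpha(X,Y)=-\alpha([X,Y]_{\mathfrak p})$. For $h=(h_0,h_1,h_2,h_3)\in\mathbb{S}^3\simeq\mathrm{Sp}(1)$, $\varphi_{(r,h)}=r^3e^{123}+\sum_{i,l=1}^3\Upsilon(h)_{il}\,e^l\wedge\omega_i$, with $$\Upsilon(h)=\begin{pmatrix}h_0^2+h_1^2-h_2^2-h_3^2&2(h_1h_2-h_0h_3)&2(h_1h_3+h_0h_2)\\2(h_1h_2+h_0h_3)&h_0^2-h_1^2+h_2^2-h_3^2&2(h_2h_3-h_0h_1)\\2(h_1h_3-h_0h_2)&2(h_2h_3+h_0h_1)&h_0^2-h_1^2-h_2^2+h_3^2\end{pmatrix};$$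 it depends only on $[h]=\{\pm h\}$, is identified with $(r,[h])$, and induces $g_r=r^2\sum_{i\le3}(e^i)^2+\frac1r\sum_{i\ge4}(e^i)^2$. The full torsion tensor $T$ of $\varphi$, with $\psi=*\varphi$, is given by $\nabla_i\varphi_{jkl}=T_i{}^m\psi_{mjkl}$. The Dirichlet energy is $E(\varphi)=\frac12\int|T_\varphi|^2\mathrm{vol}_\varphi$; the reduced energy $E^{\mathrm{red}}$ is its restriction to $\mathrm{Sp}(2)$-invariant $\mathrm{G}_2$-structures, and it is considered on a given isometric class $\mathcal{B}_r$ (where $|T|^2$ is constant on $\mathbb{S}^7$ and the volume is fixed). At a critical point $\varphi_{(r,h)}$, consider variations $\varphi_{(r,k(t,s)h)}$ with $k(t,s)$ unit quaternions, $k(0,0)=1$, $V=\frac2r\sum_{l=1}^3\frac{\partial k_l}{\partial t}(0,0)e_l$, $W=\frac2r\sum_{l=1}^3\frac{\partial k_l}{\partial s}(0,0)e_l$; then $\mathrm{Hess}(E)_{r,h}(V,W)=\frac{\partial^2}{\partial s\partial t}\big|_{t=s=0}|T_{(t,s)}|^2$ is a symmetric bilinear form on $\mathfrak{p}_1\oplus\mathfrak{p}_2\oplus\mathfrak{p}_3$, where $T_{(t,s)}$ is the full torsion tensor of $\varphi_{(r,k(t,s)h)}$. The reduced index is the dimension of the largest subspace of $\mathfrak{p}_1\oplus\mathfrak{p}_2\oplus\mathfrak{p}_3$ on which $\mathrm{Hess}(E)_{r,h}$ is negative-definite; the reduced nullity is the dimension of its degeneracy subspace (kernel). A critical point is stable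 if its reduced index is $0$, and unstable otherwise. *)

(* Defs.v *)
(* MathComp world, with MathComp-Analysis. *)
From HB Require Import structures.
From mathcomp Require Import all_boot all_order all_algebra.
From mathcomp Require Import ring.
From mathcomp Require Import all_classical all_reals all_analysis.

Set Implicit Arguments.
Unset Strict Implicit.
Unset Printing Implicit Defensive.

Import Order.TTheory GRing.Theory Num.Theory.
Import numFieldNormedType.Exports.

Local Open Scope classical_set_scope.
Local Open Scope ring_scope.

Section Quaternions.
Variable R : comNzRingType.

(* [Quat a b c d] is a + b i + c j + d k. *)
Record quat := Quat { q0 : R; q1 : R; q2 : R; q3 : R }.

Definition quat_to_prod (q : quat) := (q0 q, q1 q, q2 q, q3 q).
Definition quat_of_prod (p : R * R * R * R) :=
  Quat p.1.1.1 p.1.1.2 p.1.2 p.2.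

Lemma quat_to_prodK : cancel quat_to_prod quat_of_prod.
Proof. by case. Qed.

HB.instance Definition _ := Choice.copy quat (can_type quat_to_prodK).

Definition qadd (x y : quat) :=
  Quat (q0 x + q0 y) (q1 x + q1 y) (q2 x + q2 y) (q3 x + q3 y).
Definition qopp (x : quat) := Quat (- q0 x) (- q1 x) (- q2 x) (- q3 x).
Definition qmul (x y : quat) :=
  Quat (q0 x * q0 y - q1 x * q1 y - q2 x * q2 y - q3 x * q3 y)
       (q0 x * q1 y + q1 x * q0 y + q2 x * q3 y - q3 x * q2 y)
       (q0 x * q2 y - q1 x * q3 y + q2 x * q0 y + q3 x * q1 y)
       (q0 x * q3 y + q1 x * q2 y - q2 x * q1 y + q3 x * q0 y).

Lemma qaddA : associative qadd.
Proof. by move=> [? ? ? ?] [? ? ? ?] [? ? ? ?]; congr Quat; rewrite /= addrA. Qed.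
Lemma qaddC : commutative qadd.
Proof. by move=> [? ? ? ?] [? ? ? ?]; congr Quat; rewrite /= addrC. Qed.
Lemma qadd0 : left_id (Quat 0 0 0 0) qadd.
Proof. by move=> [? ? ? ?]; congr Quat; rewrite /= add0r. Qed.
Lemma qaddN : left_inverse (Quat 0 0 0 0) qopp qadd.
Proof. by move=> [? ? ? ?]; congr Quat; rewrite /= addNr. Qed.

HB.instance Definition _ := GRing.isZmodule.Build quat qaddA qaddC qadd0 qaddN.

Lemma qmulA : associative qmul.
Proof. by move=> [? ? ? ?] [? ? ? ?] [? ? ? ?]; congr Quat => /=; ring. Qed.
Lemma qmul1l : left_id (Quat 1 0 0 0) qmul.
Proof. by move=> [? ? ? ?]; congr Quat => /=; ring. Qed.
Lemma qmul1r : right_id (Quat 1 0 0 0) qmul.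
Proof. by move=> [? ? ? ?]; congr Quat => /=; ring. Qed.
Lemma qmulDl : left_distributive qmul qadd.
Proof. by move=> [? ? ? ?] [? ? ? ?] [? ? ? ?]; congr Quat => /=; ring. Qed.
Lemma qmulDr : right_distributive qmul qadd.
Proof. by move=> [? ? ? ?] [? ? ? ?] [? ? ? ?]; congr Quat => /=; ring. Qed.
Lemma qone_neq0 : Quat 1 0 0 0 != 0 :> quat.
Proof. by apply/eqP => -[/eqP]; rewrite oner_eq0. Qed.

HB.instance Definition _ :=
  GRing.Zmodule_isNzRing.Build quat qmulA qmul1l qmul1r qmulDl qmulDr qone_neq0.

Definition qconj (x : quat) := Quat (q0 x) (- q1 x) (- q2 x) (- q3 x).

Definition qim (l : 'I_3) (x : quat) : R := [:: q1 x; q2 x; q3 x]`_l.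

Definition unitq (x : quat) : Prop :=
  q0 x ^+ 2 + q1 x ^+ 2 + q2 x ^+ 2 + q3 x ^+ 2 = 1.

End Quaternions.

Section LieAlgebra.
Variable R : realType.

Definition mx2 (a b c d : quat R) : 'M[quat R]_2 :=
  \matrix_(i, j) (if i == 0 then (if j == 0 then a else b)
                  else (if j == 0 then c else d)).

Definition qi : quat R := Quat 0 1 0 0.
Definition qj : quat R := Quat 0 0 1 0.
Definition qk : quat R := Quat 0 0 0 1.
Definition isqrt2 : quat R := Quat (Num.sqrt 2)^-1 0 0 0.

(* The basis e_1, ..., e_7 of p; the index a : 'I_7 stands for e_(a+1). *)
Definition ebasis (a : 'I_7) : 'M[quat R]_2 :=
  [:: mx2 0 0 0 qi; mx2 0 0 0 qj; mx2 0 0 0 qk;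
      isqrt2 *: mx2 0 qi qi 0; isqrt2 *: mx2 0 qj qj 0;
      isqrt2 *: mx2 0 qk qk 0; isqrt2 *: mx2 0 1 (-1) 0]`_a.

Definition lie (X Y : 'M[quat R]_2) : 'M[quat R]_2 := X *m Y - Y *m X.

(* Bi-invariant inner product on sp(2).  The e_a are orthonormal for it and
   span the orthogonal complement p of sp(1) = {diag(x, 0)}. *)
Definition ip (X Y : 'M[quat R]_2) : R := - q0 (\tr (X *m Y)).

(* [e_i, e_j]_p = \sum_k (sc i j k) e_k; by orthonormality the coefficients of
   the p-component are inner products with the basis. *)
Definition sc (i j k : 'I_7) : R := ip (lie (ebasis i) (ebasis j)) (ebasis k).

(* Dual basis: [e a] is the coframe element e^a with a = 1, ..., 7, so that
   [e a i] is its value on the basis vector of index i : 'I_7. *)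
Definition e (a : nat) (i : 'I_7) : R := (i.+1 == a)%:R.

(* e^{ab} *)
Definition e2 (a b : nat) (i j : 'I_7) : R := e a i * e b j - e a j * e b i.

Definition wedge12 (al : 'I_7 -> R) (be : 'I_7 -> 'I_7 -> R) (i j k : 'I_7) : R :=
  al i * be j k + al j * be k i + al k * be i j.

(* [omega a] is omega_(a+1). *)
Definition omega (a : 'I_3) (i j : 'I_7) : R :=
  [:: e2 4 7 i j + e2 5 6 i j;
      e2 4 6 i j - e2 5 7 i j;
      e2 4 5 i j + e2 6 7 i j]`_a.

Definition Upsilon (h : quat R) : 'M[R]_3 :=
  let: Quat h0 h1 h2 h3 := h in
  \matrix_(i, l) (nth [::]
   [:: [:: h0 ^+ 2 + h1 ^+ 2 - h2 ^+ 2 - h3 ^+ 2; 2 * (h1 * h2 - h0 * h3);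
           2 * (h1 * h3 + h0 * h2)];
       [:: 2 * (h1 * h2 + h0 * h3); h0 ^+ 2 - h1 ^+ 2 + h2 ^+ 2 - h3 ^+ 2;
           2 * (h2 * h3 - h0 * h1)];
       [:: 2 * (h1 * h3 - h0 * h2); 2 * (h2 * h3 + h0 * h1);
           h0 ^+ 2 - h1 ^+ 2 - h2 ^+ 2 + h3 ^+ 2]] i)`_l.

Definition phi (r : R) (h : quat R) (i j k : 'I_7) : R :=
  r ^+ 3 * wedge12 (e 1) (e2 2 3) i j k
  + \sum_(a < 3) \sum_(l < 3) Upsilon h a l * wedge12 (e l.+1) (omega a) i j k.

Definition metric (r : R) : 'M[R]_7 :=
  \matrix_(i, j) (r ^+ 2 * (\sum_(1 <= a < 4) e a i * e a j)
                  + r^-1 * (\sum_(4 <= a < 8) e a i * e a j)).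

Definition cometric (r : R) : 'M[R]_7 := invmx (metric r).

(* g_r(Lambda(e_i) e_j, e_k), where Lambda : p -> so(p) is the Levi-Civita
   connection of the invariant metric g_r acting on invariant tensors, given by
   the Koszul formula.  It is metric and satisfies
   Lambda(X)Y - Lambda(Y)X = [X, Y]_p, i.e.
   d alpha (X, Y) = - alpha([X, Y]_p) for invariant 1-forms. *)
Definition levi_civita (r : R) (i j k : 'I_7) : R :=
  2^-1 * \sum_(m < 7) (sc i j m * metric r m k - sc j k m * metric r m i
                       + sc k i m * metric r m j).

Definition connection (r : R) (i j m : 'I_7) : R :=
  \sum_(n < 7) levi_civita r i j n * cometric r n m.

(* Covariant derivative of an invariant 3-form. *)
Definition nabla (r : R) (f : 'I_7 -> 'I_7 -> 'I_7 -> R) (i j k l : 'I_7) : R :=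
  - \sum_(m < 7) (connection r i j m * f m k l + connection r i k m * f j m l
                  + connection r i l m * f j k m).

(* Levi-Civita symbol of a word of length 7. *)
Definition eps7 (s : seq 'I_7) : R :=
  \prod_(p < 7) \prod_(q < 7 | (p < q)%N)
    Num.sg ((nth 0 s q : nat)%:R - (nth 0 s p : nat)%:R).

(* Hodge star of a 3-form for g_r; the orientation is the one induced by
   phi_(r,h), for which (e_1, ..., e_7) is positive. *)
Definition hodge3 (r : R) (f : 'I_7 -> 'I_7 -> 'I_7 -> R) (a b c d : 'I_7) : R :=
  (3`!%:R)^-1 * Num.sqrt (\det (metric r)) *
  \sum_(i < 7) \sum_(j < 7) \sum_(k < 7)
    (\sum_(i' < 7) \sum_(j' < 7) \sum_(k' < 7)
       cometric r i i' * cometric r j j' * cometric r k k' * f i' j' k')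
    * eps7 [:: i; j; k; a; b; c; d].

(* [is_torsion r f T]: the tensor with covariant components T_{ij} is the full
   torsion tensor of the G2-structure f inducing g_r. *)
Definition is_torsion (r : R) (f : 'I_7 -> 'I_7 -> 'I_7 -> R) (T : 'M[R]_7) : Prop :=
  forall i j k l : 'I_7,
    nabla r f i j k l =
    \sum_(m < 7) (\sum_(n < 7) T i n * cometric r n m) * hodge3 r f m j k l.

Definition torsion (r : R) (f : 'I_7 -> 'I_7 -> 'I_7 -> R) : 'M[R]_7 :=
  xget 0 [set T | is_torsion r f T].

Definition torsion_sqnorm (r : R) (f : 'I_7 -> 'I_7 -> 'I_7 -> R) : R :=
  let T := torsion r f in
  \sum_(i < 7) \sum_(j < 7) \sum_(a < 7) \sum_(b < 7)
    cometric r i a * cometric r j b * T i j * T a b.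

(* Pullback to p of the round metric of the unit sphere in H^2 under
   X |-> X (0, 1)^T; the stabiliser of (0, 1)^T in Sp(2) is Sp(1). *)
Definition round_metric : 'M[R]_7 :=
  \matrix_(i, j) \sum_(a < 2) q0 (qconj (ebasis i a 1) * ebasis j a 1).

(* Volume of (S^7, g_r); the round unit S^7 has volume pi^4 / 3. *)
Definition volume (r : R) : R :=
  Num.sqrt (\det (metric r) / \det round_metric) * (pi ^+ 4 / 3).

(* E(phi) = 1/2 \int |T|^2 vol for an invariant phi, for which |T|^2 is constant
   on S^7. *)
Definition energy (r : R) (f : 'I_7 -> 'I_7 -> 'I_7 -> R) : R :=
  2^-1 * torsion_sqnorm r f * volume r.

(* The reduced energy on B_r, lifted along the double cover S^3 -> B_r = RP^3,
   h |-> phi_(r,h). *)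
Definition Ered (r : R) (h : quat R) : R := energy r (phi r h).

(* Criticality and local minimality at [h] are tested on S^3, the covering
   S^3 -> RP^3 being a local diffeomorphism. *)
Definition critical (r : R) (h : quat R) : Prop :=
  unitq h /\
  forall c : R -> quat R,
    (forall t, unitq (c t)) -> c 0 = h ->
    derivable (fun t => q0 (c t)) (0 : R) 1 ->
    derivable (fun t => q1 (c t)) (0 : R) 1 ->
    derivable (fun t => q2 (c t)) (0 : R) 1 ->
    derivable (fun t => q3 (c t)) (0 : R) 1 ->
    is_derive (0 : R) 1 (fun t => Ered r (c t)) 0.

Definition local_min (r : R) (h : quat R) : Prop :=
  exists2 d : R, 0 < d &
    forall h' : quat R, unitq h' ->
      `|q0 h' - q0 h| < d -> `|q1 h' - q1 h| < d ->
      `|q2 h' - q2 h| < d -> `|q3 h' - q3 h| < d ->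
      Ered r h <= Ered r h'.

(* C^n and smooth functions of two real variables, by partial derivatives. *)
Fixpoint Cn2 (n : nat) (f : R -> R -> R) : Prop :=
  continuous (fun p : R * R => f p.1 p.2) /\
  if n is n'.+1 then
    [/\ forall t s, derivable (fun u => f u s) t 1,
        forall t s, derivable (fun u => f t u) s 1,
        Cn2 n' (fun t s => derive1 (fun u => f u s) t) &
        Cn2 n' (fun t s => derive1 (fun u => f t u) s)]
  else True.

Definition smooth2 (f : R -> R -> R) : Prop := forall n, Cn2 n f.

Definition variation (k : R -> R -> quat R) : Prop :=
  [/\ forall t s, unitq (k t s), k 0 0 = 1,
      smooth2 (fun t s => q0 (k t s)) &
      forall l : 'I_3, smooth2 (fun t s => qim l (k t s))].

(* Vectors of p_1 + p_2 + p_3 are given by their coordinates on e_1, e_2, e_3. *)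
Definition form (B : 'M[R]_3) (v w : 'rV[R]_3) : R := (v *m B *m w^T) 0 0.

(* [is_hessian r h B]: B is the matrix of Hess(E)_{r,h}.  At a critical point
   there is exactly one such B: variations realise all pairs (V, W). *)
Definition is_hessian (r : R) (h : quat R) (B : 'M[R]_3) : Prop :=
  B^T = B /\
  forall k : R -> R -> quat R, variation k ->
    let V := \row_(l < 3) (2 / r * derive1 (fun t => qim l (k t 0)) 0) in
    let W := \row_(l < 3) (2 / r * derive1 (fun s => qim l (k 0 s)) 0) in
    form B V W =
    derive1
      (fun s => derive1 (fun t => torsion_sqnorm r (phi r (k t s * h))) 0) 0.

Definition negdef_on (B : 'M[R]_3) (U : {vspace 'rV[R]_3}) : Prop :=
  forall v, v \in U -> v != 0 -> form B v v < 0.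

Definition form_index (B : 'M[R]_3) (n : nat) : Prop :=
  (exists2 U : {vspace 'rV[R]_3}, negdef_on B U & \dim U = n) /\
  (forall U : {vspace 'rV[R]_3}, negdef_on B U -> (\dim U <= n)%N).

Definition form_nullity (B : 'M[R]_3) (n : nat) : Prop :=
  exists2 K : {vspace 'rV[R]_3},
    (forall v, v \in K <-> forall w, form B v w = 0) & \dim K = n.

Definition reduced_index (r : R) (h : quat R) (n : nat) : Prop :=
  exists2 B, is_hessian r h B & form_index B n.

Definition reduced_nullity (r : R) (h : quat R) (n : nat) : Prop :=
  exists2 B, is_hessian r h B & form_nullity B n.

Definition stable (r : R) (h : quat R) : Prop :=
  critical r h /\ reduced_index r h 0.

Definition unstable (r : R) (h : quat R) : Prop :=
  critical r h /\ exists2 n, n <> 0%N & reduced_index r h n.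

Definition NS (h : quat R) : Prop :=
  h = Quat 0 0 1 0 \/ h = Quat 0 0 (-1) 0.

Definition RP2 (h : quat R) : Prop := unitq h /\ q2 h = 0.

End LieAlgebra.

(* Main.v *)
Require Import Defs.
From mathcomp Require Import all_boot all_order all_algebra.
From mathcomp Require Import all_classical all_reals all_analysis.
From mathcomp Require Import ring lra.
From Stdlib Require Ring_theory Ring_polynom.
Import Order.TTheory GRing.Theory Num.Theory.
Local Open Scope ring_scope.

Set Implicit Arguments.
Unset Strict Implicit.
Unset Printing Implicit Defensive.

(* |T|^2 of phi_(r,h) is an affine function of h_2^2.  In the frame e_1, ..., e_7
   the bracket of p is the 3-form 2 e^123 + e^1 omega_1 - e^2 omega_2 + e^3 omega_3,
   so the connection of g_r, the covariant derivative of phi and its Hodge dual psi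
   have entries polynomial in x = r^3 and h.  The torsion is then, in mixed
   components, 1/r times the block sum of (x - 2) D Upsilon(h) - 1 on span(e_1, e_2, e_3),
   with D = diag(1, -1, 1), and of
   2 x h_2 (h_2 + h_1 omega_3 + h_0 omega_2 - h_3 omega_1) - x / 2 on span(e_4, ..., e_7);
   it is unique because psi contracted with itself is diagonal and positive.  Hence
     r^2 |T|^2 = 4 x^2 - 14 x + 19 + 8 (x - 1) (x + 2) h_2^2,
   and everything follows from the restriction of h_2^2 to the unit sphere: its
   critical points are h_2 = 0, where its Hessian has rank one and is nonnegative,
   and h_2 = 1 or -1, where its Hessian is negative definite; the sign of
   8 (x - 1) (x + 2) is that of r - 1. *)

(** * Deciding polynomial identities by evaluation *)

Notation pexpr := (Ring_polynom.PExpr int).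
Notation PO := (@Ring_polynom.PEO int).
Notation Pc := (@Ring_polynom.PEc int).
Notation PX := (@Ring_polynom.PEX int).

(* The constructors below prune the subexpressions 0, so that the expression built
   for a component of a tensor retains only its few nonzero terms. *)
Definition padd (p q : pexpr) : pexpr :=
  match p, q with
  | Ring_polynom.PEO, _ => q
  | _, Ring_polynom.PEO => p
  | _, _ => Ring_polynom.PEadd p q
  end.

Definition pmul (p q : pexpr) : pexpr :=
  match p, q with
  | Ring_polynom.PEO, _ => PO
  | _, Ring_polynom.PEO => PO
  | _, _ => Ring_polynom.PEmul p q
  end.

Definition popp (p : pexpr) : pexpr :=
  if p is Ring_polynom.PEO then PO else Ring_polynom.PEopp p.

Definition pscale (c : int) (p : pexpr) : pexpr :=
  if c is Posz 0 then PO else pmul (Pc c) p.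

Definition psum (n : nat) (f : nat -> pexpr) : pexpr :=
  foldr padd PO [seq f i | i <- iota 0 n].

Definition subz (a b : int) : int := a - b.
Definition eqz (a b : int) : bool := a == b.
Definition edivz (a b : int) : int * int := ((a %/ b)%Z, (a %% b)%Z).

(** Both expressions are normalised as by the [ring] tactic, each hypothesis acting as a rewrite
    rule from the monomial on its left. Coefficients are matched by [edivz], and 9 bounds the rounds
    of rewriting. *)
Definition peq (hyps : seq (pexpr * pexpr)) (p q : pexpr) : bool :=
  let nf := Ring_polynom.norm_subst 0 1 +%R *%R subz -%R eqz edivz 9
    (Ring_polynom.mk_monpol_list 0 1 +%R *%R subz -%R eqz edivz hyps) in
  Ring_polynom.Peq eqz (nf p) (nf q).

Section Evaluation.
Variable R : comNzRingType.

Definition subr2 (x y : R) := x - y.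

Lemma ring_theory_comNzRing :
  Ring_theory.ring_theory 0 1 +%R *%R subr2 -%R eq.
Proof.
split=> //; [exact: add0r|exact: addrC|exact: addrA|exact: mul1r|exact: mulrC
  |exact: mulrA|exact: mulrDl|exact: subrr].
Qed.

Definition zr (a : int) : R := a%:~R.

Lemma zr_morph :
  Ring_theory.ring_morph 0 1 +%R *%R subr2 -%R eq 0 1 +%R *%R subz -%R eqz zr.
Proof.
split=> //; [exact: rmorphD|exact: rmorphB|exact: rmorphM|exact: rmorphN|].
by move=> a b /eqP ->.
Qed.

Lemma edivz_theory : Ring_theory.div_theory eq +%R *%R zr edivz.
Proof. by split=> a b /=; rewrite mulrC -divz_eq. Qed.

Definition ev (env : seq R) : pexpr -> R :=
  Ring_polynom.PEeval 0 1 +%R *%R subr2 -%R zr (@id BinNums.N)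
    (Ring_theory.pow_N 1 *%R) env.

Lemma ev_padd env p q : ev env (padd p q) = ev env p + ev env q.
Proof. by case: p => *; case: q => * //; rewrite /= ?add0r ?addr0. Qed.

Lemma ev_pmul env p q : ev env (pmul p q) = ev env p * ev env q.
Proof. by case: p => *; case: q => * //; rewrite /= ?mul0r ?mulr0. Qed.

Lemma ev_popp env p : ev env (popp p) = - ev env p.
Proof. by case: p => * //=; rewrite /= oppr0. Qed.

Lemma ev_pscale env c p : ev env (pscale c p) = c%:~R * ev env p.
Proof. by case: c => [[|c]|c]; rewrite /pscale ?ev_pmul //= mul0r. Qed.

Lemma ev_psum env n (f : nat -> pexpr) (F : 'I_n -> R) :
  (forall i, F i = ev env (f i)) -> \sum_(i < n) F i = ev env (psum n f).
Proof.
move=> eF; rewrite (eq_bigr (fun i : 'I_n => ev env (f i))) //.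
rewrite -(big_mkord xpredT (fun i => ev env (f i))) /psum /index_iota subn0.
by elim: (iota 0 n) => [|i s IHs]; rewrite ?big_nil // big_cons IHs /= ev_padd.
Qed.

Fixpoint holds (env : seq R) (hyps : seq (pexpr * pexpr)) : Prop :=
  if hyps is (p, q) :: hyps' then ev env p = ev env q /\ holds env hyps' else True.

(** Soundness of the reflection: one computation with integer coefficients gives an identity in
    every commutative ring, at any values satisfying [hyps]. *)
Lemma peqP env hyps p q : holds env hyps -> peq hyps p q -> ev env p = ev env q.
Proof.
move=> Hh.
have Hi : Ring_polynom.interp_PElist 0 1 +%R *%R subr2 -%R eq zr
    (@id BinNums.N) (Ring_theory.pow_N 1 *%R) env hyps.
  elim: hyps Hh => // -[p1 p2] [|h hyps] IH [] //= e1 Hh; split=> //; exact: IH.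
have eqR := RelationClasses.eq_equivalence (A := R).
have extR := Ring_theory.Eq_ext +%R *%R (-%R : R -> R).
exact: (Ring_polynom.ring_correct eqR extR
  (Ring_theory.Rth_ARth eqR extR ring_theory_comNzRing) zr_morph
  (Ring_theory.pow_N_th 1 *%R eqR) edivz_theory 9 env hyps p q Hi).
Qed.

End Evaluation.

(** * Structure constants *)

Record pquat := PQuat { p0 : pexpr; p1 : pexpr; p2 : pexpr; p3 : pexpr }.

Definition pqadd (a b : pquat) :=
  PQuat (padd (p0 a) (p0 b)) (padd (p1 a) (p1 b)) (padd (p2 a) (p2 b)) (padd (p3 a) (p3 b)).
Definition pqopp (a : pquat) := PQuat (popp (p0 a)) (popp (p1 a)) (popp (p2 a)) (popp (p3 a)).
Definition psub (p q : pexpr) := padd p (popp q).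
Definition pqmul (x y : pquat) :=
  PQuat
   (psub (psub (psub (pmul (p0 x) (p0 y)) (pmul (p1 x) (p1 y)))
      (pmul (p2 x) (p2 y))) (pmul (p3 x) (p3 y)))
   (psub (padd (padd (pmul (p0 x) (p1 y)) (pmul (p1 x) (p0 y)))
      (pmul (p2 x) (p3 y))) (pmul (p3 x) (p2 y)))
   (padd (padd (psub (pmul (p0 x) (p2 y)) (pmul (p1 x) (p3 y)))
      (pmul (p2 x) (p0 y))) (pmul (p3 x) (p1 y)))
   (padd (psub (padd (pmul (p0 x) (p3 y)) (pmul (p1 x) (p2 y)))
      (pmul (p2 x) (p1 y))) (pmul (p3 x) (p0 y))).

(* The i, j entry of e_(a+1); the only variable stands for 1 / sqrt 2. *)
Definition pbasis (a i j : nat) : pquat :=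
  let s := PX BinNums.xH in
  match a, i, j with
  | 0, 1, 1 => PQuat PO (Pc 1) PO PO
  | 1, 1, 1 => PQuat PO PO (Pc 1) PO
  | 2, 1, 1 => PQuat PO PO PO (Pc 1)
  | 3, 0, 1 | 3, 1, 0 => PQuat PO s PO PO
  | 4, 0, 1 | 4, 1, 0 => PQuat PO PO s PO
  | 5, 0, 1 | 5, 1, 0 => PQuat PO PO PO s
  | 6, 0, 1 => PQuat s PO PO PO
  | 6, 1, 0 => PQuat (popp s) PO PO PO
  | _, _, _ => PQuat PO PO PO PO
  end%N.

Definition pqmx_mul (X Y : nat -> nat -> pquat) (i j : nat) : pquat :=
  pqadd (pqmul (X i 0) (Y 0 j)) (pqmul (X i 1) (Y 1 j)).
Definition plie X Y (i j : nat) : pquat :=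
  pqadd (pqmx_mul X Y i j) (pqopp (pqmx_mul Y X i j)).
Definition pip X Y : pexpr :=
  popp (padd (p0 (pqmx_mul X Y 0 0)) (p0 (pqmx_mul X Y 1 1))).
Definition psc (i j k : nat) := pip (plie (pbasis i) (pbasis j)) (pbasis k).

Definition eZ (a i : nat) : int := if (i.+1 == a)%N then 1 else 0.
Definition e2Z (a b i j : nat) := eZ a i * eZ b j - eZ a j * eZ b i.
Definition wedge12Z (al : nat -> int) (be : nat -> nat -> int) (i j k : nat) :=
  al i * be j k + al j * be k i + al k * be i j.
Definition omegaZ (a i j : nat) :=
  match a with
  | 0%N => e2Z 4 7 i j + e2Z 5 6 i j
  | 1%N => e2Z 4 6 i j - e2Z 5 7 i j
  | _ => e2Z 4 5 i j + e2Z 6 7 i j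
  end.

(** The bracket with its third index lowered by [ip]. It is totally antisymmetric because [ip] is
    bi-invariant, so wedge products suffice to write it. *)
Definition scZ (i j k : nat) : int :=
  2 * wedge12Z (eZ 1) (e2Z 2 3) i j k + wedge12Z (eZ 1) (omegaZ 0) i j k
  - wedge12Z (eZ 2) (omegaZ 1) i j k + wedge12Z (eZ 3) (omegaZ 2) i j k.

Definition allI (n : nat) (P : nat -> bool) := all P (iota 0 n).
Lemma allIP n P (i : 'I_n) : allI n P -> P i.
Proof. by move=> /allP; apply; rewrite mem_iota ltn_ord. Qed.

(* The variable is 1 / sqrt 2, as in pbasis. *)
Definition sqrt_hyp := [:: (pscale 2 (pmul (PX BinNums.xH) (PX BinNums.xH)), Pc 1)].

Lemma psc_check : allI 7 (fun i => allI 7 (fun j => allI 7 (fun k =>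
  peq sqrt_hyp (psc i j k) (Pc (scZ i j k))))).
Proof. by vm_compute. Qed.

Lemma quat_ext (R : comNzRingType) (x y : quat R) :
  q0 x = q0 y -> q1 x = q1 y -> q2 x = q2 y -> q3 x = q3 y -> x = y.
Proof. by case: x => ? ? ? ?; case: y => ? ? ? ? /= -> -> -> ->. Qed.

Section StructureConstants.
Variable R : realType.

Let env : seq R := [:: (Num.sqrt 2)^-1].

Definition evq (x : pquat) : quat R :=
  Quat (ev env (p0 x)) (ev env (p1 x)) (ev env (p2 x)) (ev env (p3 x)).

Lemma evqD x y : evq (pqadd x y) = evq x + evq y.
Proof. by rewrite /evq /= !ev_padd. Qed.
Lemma evqN x : evq (pqopp x) = - evq x.
Proof. by rewrite /evq /= !ev_popp. Qed.
Lemma evqM x y : evq (pqmul x y) = evq x * evq y.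
Proof. by rewrite /evq /= /psub !(ev_padd, ev_popp, ev_pmul). Qed.

Lemma ebasisE (a : 'I_7) (i j : 'I_2) : ebasis R a i j = evq (pbasis a i j).
Proof.
case: a => [[|[|[|[|[|[|[|//]]]]]]] la]; case: i => [[|[|//]] li];
case: j => [[|[|//]] lj]; rewrite /ebasis /= !mxE.
all: by apply: quat_ext;
  rewrite /= ?(mulr0, mul0r, mulr1, mul1r, subr0, addr0, add0r, oppr0, mulrN).
Qed.

Lemma mulmx_evq (X Y : 'M[quat R]_2) (X' Y' : nat -> nat -> pquat) :
  (forall i j : 'I_2, X i j = evq (X' i j)) -> (forall i j : 'I_2, Y i j = evq (Y' i j)) ->
  forall i j : 'I_2, (X *m Y) i j = evq (pqmx_mul X' Y' i j).
Proof.
by move=> eX eY i j; rewrite mxE !big_ord_recl big_ord0 addr0 evqD !evqM !eX !eY.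
Qed.

Lemma holds_sqrt : holds env sqrt_hyp.
Proof.
split=> //=; rewrite /zr /= -expr2 exprVn sqr_sqrtr // mulfV // pnatr_eq0.
Qed.

Lemma scE (i j k : 'I_7) : sc R i j k = (scZ i j k)%:~R.
Proof.
have := allIP k (allIP j (allIP i psc_check)).
move=> /(@peqP _ env) e_sc.
rewrite -[RHS]/(ev env (Pc (scZ i j k))) -e_sc; last exact: holds_sqrt.
rewrite /sc /ip.
have eL : forall u v : 'I_2,
    lie (ebasis R i) (ebasis R j) u v = evq (plie (pbasis i) (pbasis j) u v).
  move=> u v; rewrite /lie [LHS]mxE [in X in _ + X]mxE evqD evqN.
  by congr (_ - _); apply: mulmx_evq => a b; exact: ebasisE.
rewrite /mxtrace !big_ord_recl big_ord0 addr0 !(mulmx_evq eL (@ebasisE k)).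
by rewrite /psc /pip ev_popp ev_padd.
Qed.
End StructureConstants.

(** * Connection, covariant derivative and Hodge dual *)

(* From here on the variables are x = r^3, h_0, h_1, h_2 and h_3. *)
Notation Px := (PX BinNums.xH).
Notation Ph0 := (PX (BinNums.xO BinNums.xH)).
Notation Ph1 := (PX (BinNums.xI BinNums.xH)).
Notation Ph2 := (PX (BinNums.xO (BinNums.xO BinNums.xH))).
Notation Ph3 := (PX (BinNums.xI (BinNums.xO BinNums.xH))).

(* Twice the coefficient of e_m in the derivative of e_j along e_i.  By total
   antisymmetry of the bracket, Koszul's formula reads
   (g_m - g_i + g_j) / g_m * scZ i j m. *)
Definition pconn (i j m : nat) : pexpr :=
  pscale (scZ i j m)
    match (i < 3)%N, (j < 3)%N, (m < 3)%N with
    | true, true, true | false, false, true => Pc 1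
    | true, false, false => psub (Pc 2) Px
    | false, true, false => Px
    | _, _, _ => PO
    end.

Lemma scZ_cyclic : allI 7 (fun i => allI 7 (fun j => allI 7 (fun k =>
  scZ i j k == scZ j k i))).
Proof. by vm_compute. Qed.

(** Conjugation by diag(1, -1) preserves the bracket, fixes e_1, e_2, e_3 and negates e_4, ..., e_7;
    a nonzero component therefore has an even number of indices of the second kind. *)
Lemma scZ_graded : allI 7 (fun i => allI 7 (fun j => allI 7 (fun k =>
  (i < 3) (+) (j < 3) (+) (k < 3) || (scZ i j k == 0))))%N.
Proof. by vm_compute. Qed.

Section InvariantMetric.
Variables (R : realType) (r : R).
Hypothesis r_gt0 : 0 < r.

Definition gdiag (i : 'I_7) : R := if (i < 3)%N then r ^+ 2 else r^-1.

Lemma gdiag_gt0 i : 0 < gdiag i.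
Proof. by rewrite /gdiag; case: ifP; rewrite ?exprn_gt0 ?invr_gt0. Qed.

Lemma gdiag_neq0 i : gdiag i != 0.
Proof. by rewrite gt_eqF ?gdiag_gt0. Qed.

Lemma metricE : metric r = diag_mx (\row_i gdiag i).
Proof.
apply/matrixP => i j; rewrite !mxE /gdiag.
have sumE (m n : nat) : \sum_(m <= a < n) e R a i * e R a j
    = (((m <= i.+1 < n)%N && (i == j))%:R).
  case: (boolP (m <= i.+1 < n)%N) => [imn|inmn] /=.
    rewrite (bigD1_seq i.+1) ?mem_index_iota ?iota_uniq //= {1 2}/e eqxx mul1r big1.
      by rewrite addr0 eqSS eq_sym.
    by move=> a /negPf ai; rewrite /e eq_sym ai mul0r.
  rewrite big_nat_cond big1 // => a /andP[amn _]; rewrite /e.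
  by case: eqP => [ia|_]; rewrite ?mul0r // ia amn in inmn *.
rewrite !sumE /= !ltnS (_ : (i <= 6)%N); last by rewrite -ltnS ltn_ord.
by case: leqP; rewrite /= ?(mulr0, addr0, add0r) mulr_natr.
Qed.

Lemma cometricE : cometric r = diag_mx (\row_i (gdiag i)^-1).
Proof.
have gV : metric r *m diag_mx (\row_i (gdiag i)^-1) = 1%:M.
  rewrite metricE mulmx_diag; apply/matrixP => i j.
  by rewrite !mxE mulfV ?gdiag_neq0.
by rewrite /cometric -[LHS]mulmx1 -gV mulKmx //; case: (mulmx1_unit gV).
Qed.

Lemma sum_metric (F : 'I_7 -> R) k : \sum_m F m * metric r m k = F k * gdiag k.
Proof.
rewrite (bigD1 k) //= big1 ?addr0 => [|m mk]; first by rewrite metricE !mxE eqxx mulr1n.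
by rewrite metricE !mxE (negPf mk) mulr0.
Qed.

Lemma sum_cometric (F : 'I_7 -> R) k : \sum_m F m * cometric r m k = F k / gdiag k.
Proof.
rewrite (bigD1 k) //= big1 ?addr0 => [|m mk]; first by rewrite cometricE !mxE eqxx mulr1n.
by rewrite cometricE !mxE (negPf mk) mulr0.
Qed.

Lemma cometricC (i j : 'I_7) : cometric r i j = cometric r j i.
Proof. by rewrite cometricE // !mxE eq_sym; case: eqP => // ->. Qed.

Variable env : seq R.

Lemma connectionE (i j m : 'I_7) :
  2 * connection r i j m = ev (r ^+ 3 :: env) (pconn i j m).
Proof.
have r0 : r != 0 by rewrite gt_eqF.
rewrite /connection sum_cometric /levi_civita big_split sumrB /= !sum_metric !scE.
(* The other two Koszul terms are cyclic rotations of the first, so [scZ i j m] factors out. *)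
have /eqP <- := allIP m (allIP j (allIP i scZ_cyclic)).
have /eqP -> := allIP j (allIP i (allIP m scZ_cyclic)).
rewrite /pconn ev_pscale /gdiag.
have := allIP m (allIP j (allIP i scZ_graded)).
case: (i < 3)%N; case: (j < 3)%N; case: (m < 3)%N => /= sc0;
  rewrite ?(eqP sc0) /psub ?ev_padd ?ev_popp /= /zr; field.
all: by [].
Qed.
End InvariantMetric.

(** * Symbolic components of phi, psi and the torsion, and the identities between them *)

Definition psqr p := pmul p p.

Definition pUpsilon (a l : nat) : pexpr :=
  match a, l with
  | 0, 0 => psub (psub (padd (psqr Ph0) (psqr Ph1)) (psqr Ph2)) (psqr Ph3)
  | 0, 1 => pscale 2 (psub (pmul Ph1 Ph2) (pmul Ph0 Ph3))
  | 0, 2 => pscale 2 (padd (pmul Ph1 Ph3) (pmul Ph0 Ph2))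
  | 1, 0 => pscale 2 (padd (pmul Ph1 Ph2) (pmul Ph0 Ph3))
  | 1, 1 => psub (padd (psub (psqr Ph0) (psqr Ph1)) (psqr Ph2)) (psqr Ph3)
  | 1, 2 => pscale 2 (psub (pmul Ph2 Ph3) (pmul Ph0 Ph1))
  | 2, 0 => pscale 2 (psub (pmul Ph1 Ph3) (pmul Ph0 Ph2))
  | 2, 1 => pscale 2 (padd (pmul Ph2 Ph3) (pmul Ph0 Ph1))
  | 2, 2 => padd (psub (psub (psqr Ph0) (psqr Ph1)) (psqr Ph2)) (psqr Ph3)
  | _, _ => PO
  end%N.

Definition e123Z (i j k : nat) : int := wedge12Z (eZ 1) (e2Z 2 3) i j k.

Definition pmixed (i j k : nat) : pexpr :=
  psum 3 (fun a => psum 3 (fun l =>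
    pscale (wedge12Z (eZ l.+1) (omegaZ a) i j k) (pUpsilon a l))).

(* Tables of components, which vm_compute evaluates only once. *)
Definition memo3 (f : nat -> nat -> nat -> pexpr) : seq (seq (seq pexpr)) :=
  mkseq (fun i => mkseq (fun j => mkseq (f i j) 7) 7) 7.
Definition get3 (t : seq (seq (seq pexpr))) (i j k : nat) : pexpr :=
  nth PO (nth [::] (nth [::] t i) j) k.

Lemma get3_memo f (i j k : 'I_7) : get3 (memo3 f) i j k = f i j k.
Proof. by rewrite /get3 /memo3 !nth_mkseq. Qed.

Definition memo4 (f : nat -> nat -> nat -> nat -> pexpr) :=
  mkseq (fun i => memo3 (f i)) 7.
Definition get4 (t : seq (seq (seq (seq pexpr)))) (i j k l : nat) : pexpr :=
  get3 (nth [::] t i) j k l.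

Lemma get4_memo f (i j k l : 'I_7) : get4 (memo4 f) i j k l = f i j k l.
Proof. by rewrite /get4 /memo4 nth_mkseq // get3_memo. Qed.

Definition pphi (i j k : nat) := padd (pscale (e123Z i j k) Px) (pmixed i j k).

(* r^3 times phi with its indices raised by g_r. *)
Definition pstar (i j k : nat) := padd (pscale (e123Z i j k) (Pc 1)) (pmul Px (pmixed i j k)).

Definition conn_table := memo3 pconn.
Definition phi_table := memo3 pphi.
Definition star_table := memo3 pstar.

Definition sgZ (a b : nat) : int := if (a < b)%N then 1 else if a == b then 0 else -1.
Definition zprod (s : seq int) : int := foldr *%R 1 s.
Fixpoint epsZ (s : seq nat) : int :=
  if s is a :: s' then zprod [seq sgZ a b | b <- s'] * epsZ s' else 1.

(* epsZ s = 0 makes epsZ vanish on every extension of s, so a whole sum can be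
   skipped; without this the 7^7 terms of the Hodge star would all be computed. *)
Definition pcontract (s : seq nat) (f : nat -> pexpr) : pexpr :=
  if epsZ s == 0 then PO else psum 7 f.

Definition phodge (a b c d : nat) : pexpr :=
  pcontract [:: a; b; c; d] (fun k => pcontract [:: k; a; b; c; d] (fun j =>
    pcontract [:: j; k; a; b; c; d] (fun i =>
      pscale (epsZ [:: i; j; k; a; b; c; d]) (get3 star_table i j k)))).

Definition wedge22Z (al be : nat -> nat -> int) (i j k l : nat) : int :=
  al i j * be k l - al i k * be j l + al i l * be j k
  + al j k * be i l - al j l * be i k + al k l * be i j.

(* r^2 psi: the Hodge star maps e^l omega_i to a multiple of e^(l+1, l+2) omega_i
   (indices mod 3), the omega_i being self-dual. *)
Definition ppsi (a b c d : nat) : pexpr :=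
  padd (pscale (wedge22Z (e2Z 4 5) (e2Z 6 7) a b c d) (Pc 1))
   (pmul Px (psum 3 (fun i => psum 3 (fun l =>
     pscale
       (wedge22Z (e2Z (nth 0 [:: 2; 3; 1] l)%N (nth 0 [:: 3; 1; 2] l)%N) (omegaZ i) a b c d)
       (pUpsilon i l))))).

Definition psi_table := memo4 ppsi.

(** The factor 6 is the 3! by which [hodge3] divides: every ordering of the contracted indices
    contributes equally. *)
Lemma phodge_check : allI 7 (fun a => allI 7 (fun b => allI 7 (fun c => allI 7 (fun d =>
  peq [::] (phodge a b c d) (pscale 6 (get4 psi_table a b c d)))))).
Proof. by vm_compute. Qed.

(** Evaluation by [vm_compute] is call by value; the thunk spares the second factor when the first
    is 0. *)
Definition pmul_lazy (p : pexpr) (q : unit -> pexpr) : pexpr :=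
  if p is Ring_polynom.PEO then PO else pmul p (q tt).

Definition pnabla (i j k l : nat) : pexpr :=
  popp (psum 7 (fun m => padd
    (padd (pmul_lazy (get3 conn_table i j m) (fun=> get3 phi_table m k l))
          (pmul_lazy (get3 conn_table i k m) (fun=> get3 phi_table j m l)))
    (pmul_lazy (get3 conn_table i l m) (fun=> get3 phi_table j k m)))).

(* 2 r T_i^m. *)
Definition ptau (i m : nat) : pexpr :=
  padd
   (if (i < 3)%N && (m < 3)%N then
      psub (pscale ((-1) ^+ i) (pmul (pscale 2 (psub Px (Pc 2))) (pUpsilon i m)))
           (pscale (if i == m then 2 else 0) (Pc 1))
    else if i == m then pmul Px (psub (pscale 4 (psqr Ph2)) (Pc 1)) else PO)
   (pmul (pmul (pscale 4 Px) Ph2)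
     (psub (padd (pscale (omegaZ 2 i m) Ph1) (pscale (omegaZ 1 i m) Ph0))
           (pscale (omegaZ 0 i m) Ph3))).

Definition unit_hyp :=
  [:: (psqr Ph0, psub (psub (psub (Pc 1) (psqr Ph1)) (psqr Ph2)) (psqr Ph3))].

(** The torsion equation multiplied by 2 r^3: [pnabla] is twice the covariant derivative of phi,
    [ptau] carries a factor 2 r and [psi_table] a factor r^2. *)
Lemma ptau_check : allI 7 (fun i => allI 7 (fun j => allI 7 (fun k => allI 7 (fun l =>
  peq unit_hyp (pmul Px (pnabla i j k l))
    (psum 7 (fun m => pmul (ptau i m) (get4 psi_table m j k l))))))).
Proof. by vm_compute. Qed.

(** The contraction is taken in the frame, without raising indices, so instead of the usual 24 g it
    gives these diagonal entries, still positive. *)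
Definition psi_norm (n : nat) : pexpr :=
  if (n < 3)%N then pscale 24 (psqr Px) else padd (Pc 6) (pscale 18 (psqr Px)).

Lemma ppsi_check : allI 7 (fun m => allI 7 (fun n =>
  peq unit_hyp
   (psum 7 (fun j => psum 7 (fun k => psum 7 (fun l =>
      pmul (get4 psi_table m j k l) (get4 psi_table n j k l)))))
   (pscale (if m == n then 1 else 0) (psi_norm n)))).
Proof. by vm_compute. Qed.

(** Both sides are 4 r^2 |T|^2. Summing plain squares of mixed components is legitimate because T
    preserves the two blocks on which g_r is a multiple of the identity. *)
Lemma ptau_norm_check :
  peq unit_hyp (psum 7 (fun i => psum 7 (fun m => psqr (ptau i m))))
    (pscale 4 (padd (padd (psub (pscale 4 (psqr Px)) (pscale 14 Px)) (Pc 19))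
     (pscale 8 (pmul (pmul (psub Px (Pc 1)) (padd Px (Pc 2))) (psqr Ph2))))).
Proof. by vm_compute. Qed.

Lemma e123Z_graded : allI 7 (fun i => allI 7 (fun j => allI 7 (fun k =>
  [&& i < 3, j < 3 & k < 3] || (e123Z i j k == 0))))%N.
Proof. by vm_compute. Qed.

Definition is_PO (p : pexpr) : bool := if p is Ring_polynom.PEO then true else false.

(** Exactly one index of e^l omega_a is below 3, so raising all three multiplies by r^-2 r r = 1,
    against r^-6 for e^123; this explains the coefficients of [pstar]. The test for 0 can be
    syntactic because the constructors prune. *)
Lemma pmixed_graded : allI 7 (fun i => allI 7 (fun j => allI 7 (fun k =>
  (i < 3) (+) (j < 3) (+) (k < 3) && ~~ [&& i < 3, j < 3 & k < 3]
  || is_PO (pmixed i j k))))%N.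
Proof. by vm_compute. Qed.

Lemma ev_pmul_lazy (R : comNzRingType) (env : seq R) p q :
  ev env (pmul_lazy p q) = ev env p * ev env (q tt).
Proof. by rewrite -ev_pmul; case: p. Qed.

(** * The tensors of the statement as evaluations of the symbolic tables *)

Section InvariantForms.
Variables (R : realType) (r : R) (h : quat R).
Hypothesis r_gt0 : 0 < r.

Lemma eE a (i : 'I_7) : e R a i = (eZ a i)%:~R.
Proof. by rewrite /e /eZ; case: ifP => _; rewrite ?rmorph1 ?rmorph0. Qed.

Lemma e2E a b (i j : 'I_7) : e2 R a b i j = (e2Z a b i j)%:~R.
Proof. by rewrite /e2 !eE /e2Z rmorphB !rmorphM. Qed.

Lemma omegaE (a : 'I_3) (i j : 'I_7) : omega R a i j = (omegaZ a i j)%:~R.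
Proof.
by case: a => [[|[|[|//]]] la]; rewrite /omega /omegaZ /= !e2E;
  [exact/esym/intrD|exact/esym/intrB|exact/esym/intrD].
Qed.

Lemma wedge12E (al : 'I_7 -> R) (be : 'I_7 -> 'I_7 -> R)
    (alZ : nat -> int) (beZ : nat -> nat -> int) (i j k : 'I_7) :
  (forall i : 'I_7, al i = (alZ i)%:~R) -> (forall i j : 'I_7, be i j = (beZ i j)%:~R) ->
  wedge12 al be i j k = (wedge12Z alZ beZ i j k)%:~R.
Proof. by move=> ealZ ebeZ; rewrite /wedge12 !ealZ !ebeZ /wedge12Z !rmorphD !rmorphM. Qed.

Definition hvars : seq R := [:: q0 h; q1 h; q2 h; q3 h].
Local Notation env := (r ^+ 3 :: hvars).

Lemma UpsilonE (a l : 'I_3) : Upsilon h a l = ev env (pUpsilon a l).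
Proof.
rewrite /hvars; case: h => h0 h1 h2 h3.
by case: a => [[|[|[|//]]] la]; case: l => [[|[|[|//]]] ll]; rewrite /Upsilon mxE /=; ring.
Qed.

Lemma pmixedE (i j k : 'I_7) :
  \sum_(a < 3) \sum_(l < 3) Upsilon h a l * wedge12 (e R l.+1) (omega R a) i j k
  = ev env (pmixed i j k).
Proof.
apply: ev_psum => a; apply: ev_psum => l.
rewrite ev_pscale -UpsilonE mulrC; congr (_ * _).
by apply: wedge12E => *; rewrite ?eE ?omegaE.
Qed.

Lemma e123E (i j k : 'I_7) : wedge12 (e R 1) (e2 R 2 3) i j k = (e123Z i j k)%:~R.
Proof. by apply: wedge12E => *; rewrite ?eE ?e2E. Qed.

Lemma phiE (i j k : 'I_7) : phi r h i j k = ev env (get3 phi_table i j k).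
Proof. by rewrite get3_memo /pphi ev_padd ev_pscale -pmixedE -e123E mulrC. Qed.

Lemma conn_tableE (i j m : 'I_7) : 2 * connection r i j m = ev env (get3 conn_table i j m).
Proof. by rewrite get3_memo (connectionE r_gt0 hvars). Qed.

Lemma nablaE (i j k l : 'I_7) :
  2 * nabla r (phi r h) i j k l = ev env (pnabla i j k l).
Proof.
rewrite /nabla mulrN ev_popp mulr_sumr; congr (- _); apply: ev_psum => m.
rewrite !phiE 2!ev_padd 2!mulrDr 3!(mulrA 2) !conn_tableE.
by rewrite 3!ev_pmul_lazy.
Qed.

Lemma det_metric : \det (metric r) = r ^+ 2.
Proof.
rewrite metricE det_diag !big_ord_recl big_ord0 !mxE /gdiag /=.
by field; rewrite gt_eqF.
Qed.

Lemma starE (i j k : 'I_7) :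
  r ^+ 3 * (phi r h i j k / gdiag r i / gdiag r j / gdiag r k)
  = ev env (get3 star_table i j k).
Proof.
have r0 : r != 0 by rewrite gt_eqF.
rewrite phiE !get3_memo !(ev_padd _ (pscale (e123Z i j k) _)).
rewrite !(ev_pscale _ (e123Z i j k)) ev_pmul /gdiag.
have: ~~ [&& i < 3, j < 3 & k < 3]%N -> (e123Z i j k)%:~R = 0 :> R.
  by move/negPf=> nh; have := allIP k (allIP j (allIP i e123Z_graded)); rewrite nh => /eqP ->.
have: ~~ ((i < 3) (+) (j < 3) (+) (k < 3) && ~~ [&& i < 3, j < 3 & k < 3])%N ->
    ev env (pmixed i j k) = 0.
  move/negPf=> nh; have := allIP k (allIP j (allIP i pmixed_graded)); rewrite nh.
  by case: (pmixed i j k).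
move: (ev env (pmixed i j k)) (_%:~R : R) => b a.
case: (i < 3)%N; case: (j < 3)%N; case: (k < 3)%N => b0 a0;
  try rewrite (b0 isT); try rewrite (a0 isT); rewrite /= /zr; by field.
Qed.

Lemma epsE (a b c d x y z : 'I_7) : eps7 R [:: a; b; c; d; x; y; z]
  = (epsZ [:: (a : nat); (b : nat); (c : nat); (d : nat);
              (x : nat); (y : nat); (z : nat)])%:~R.
Proof.
have sgE (i j : 'I_7) : Num.sg ((j : nat)%:R - (i : nat)%:R : R) = (sgZ i j)%:~R.
  rewrite /sgZ; case: (ltngtP i j) => [ij|ji|->].
  - by rewrite gtr0_sg // subr_gt0 ltr_nat.
  - by rewrite ltr0_sg // subr_lt0 ltr_nat.
  - by rewrite subrr sgr0.
rewrite /eps7.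
under eq_bigr => p _ do rewrite big_mkcond.
rewrite !big_ord_recl !big_ord0 /= !sgE.
by rewrite !rmorphM /= rmorph1 !mul1r !mulr1.
Qed.

Lemma pcontractE (s : seq nat) (f : nat -> pexpr) (F : 'I_7 -> R) :
  (forall i, F i = ev env (f i)) -> (epsZ s = 0 -> forall i, F i = 0) ->
  \sum_(i < 7) F i = ev env (pcontract s f).
Proof.
rewrite /pcontract => Ff F0; case: eqP => [/F0 s0|_]; last exact: ev_psum.
by rewrite big1.
Qed.

Lemma epsZ_cons (a : nat) s : epsZ s = 0 -> epsZ (a :: s) = 0.
Proof. by move=> /= ->; rewrite mulr0. Qed.

Local Arguments epsZ : simpl never.

Lemma raiseE (f : 'I_7 -> 'I_7 -> 'I_7 -> R) (i j k : 'I_7) :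
  \sum_(i' < 7) \sum_(j' < 7) \sum_(k' < 7)
     cometric r i i' * cometric r j j' * cometric r k k' * f i' j' k'
  = f i j k / gdiag r i / gdiag r j / gdiag r k.
Proof.
have sumE (F : 'I_7 -> R) a : \sum_(b < 7) cometric r a b * F b = F a / gdiag r a.
  rewrite -sum_cometric //; apply: eq_bigr => b _.
  by rewrite mulrC cometricC.
transitivity (\sum_(i' < 7) cometric r i i' * \sum_(j' < 7) cometric r j j' *
    \sum_(k' < 7) cometric r k k' * f i' j' k').
  apply: eq_bigr => i' _; rewrite mulr_sumr; apply: eq_bigr => j' _.
  by rewrite !mulr_sumr; apply: eq_bigr => k' _; rewrite !mulrA.
under eq_bigr => i' _. under eq_bigr => j' _ do rewrite sumE.
  rewrite sumE. over.
by rewrite sumE mulrAC (mulrAC (f i j k)) mulrAC.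
Qed.

Lemma hodge3E (a b c d : 'I_7) :
  r ^+ 2 * hodge3 r (phi r h) a b c d = ev env (get4 psi_table a b c d).
Proof.
have r0 : r != 0 by rewrite gt_eqF.
have := allIP d (allIP c (allIP b (allIP a phodge_check))).
move=> /(@peqP _ env [::] _ _ I); rewrite [RHS]ev_pscale => psi6.
apply: (@mulfI _ 6%:R); first by rewrite pnatr_eq0.
rewrite -[RHS]psi6 /hodge3 det_metric sqrtr_sqr gtr0_norm // (_ : 3`! = 6)%N //.
(* The square root of det g_r is r; with the prefactor r^2 it makes the r^3 that [starE] absorbs. *)
set X := \sum_(i < 7) _; rewrite (_ : 6 * _ = r ^+ 3 * X); last by field.
rewrite {}/X.
under eq_bigr => i _. under eq_bigr => j _. under eq_bigr => k _.
  rewrite raiseE. over. over. over.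
rewrite mulr_sumr.
under eq_bigr => i _. rewrite mulr_sumr.
  under eq_bigr => j _. rewrite mulr_sumr.
    under eq_bigr => k _. rewrite mulrA starE epsE mulrC. over. over. over.
(* The sum over k is brought outermost, as in [phodge]: words grow at the front, so the partial
   words on which [epsZ] is tested are suffixes of the full one. *)
rewrite exchange_big /=; under eq_bigr => j _ do rewrite exchange_big /=.
rewrite exchange_big /=.
apply: pcontractE => [k|e0 k]; last first.
  rewrite big1 // => j _; rewrite big1 // => i _.
  by rewrite (@epsZ_cons i _ (@epsZ_cons j _ (@epsZ_cons k _ e0))) mul0r.
apply: pcontractE => [j|e0 j]; last first.
  by rewrite big1 // => i _; rewrite (@epsZ_cons i _ (@epsZ_cons j _ e0)) mul0r.
apply: pcontractE => [i|e0 i]; last by rewrite (@epsZ_cons i _ e0) mul0r.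
by rewrite ev_pscale.
Qed.
End InvariantForms.

(** * Torsion *)

(** Nonzero entries join indices with the same metric coefficient, so in |T|^2 the factors from
    lowering one index and raising the other cancel. *)
Lemma ptau_graded : allI 7 (fun i => allI 7 (fun m =>
  ((i < 3) == (m < 3)) || is_PO (ptau i m)))%N.
Proof. by vm_compute. Qed.

Section Torsion.
Variables (R : realType) (r : R) (h : quat R).
Hypotheses (r_gt0 : 0 < r) (h_unit : unitq h).
Local Notation env := (r ^+ 3 :: hvars h).

Let r_neq0 : r != 0. Proof. by rewrite gt_eqF. Qed.

Lemma holds_unit : holds env unit_hyp.
Proof.
split=> //; move: h_unit; rewrite /unitq /= /zr /subr2 => <-; ring.
Qed.

Definition torsion_mx : 'M[R]_7 :=
  \matrix_(i, m) (ev env (ptau i m) / (2 * r) * gdiag r m).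

Lemma torsion_mxE (i m : 'I_7) :
  \sum_(n < 7) torsion_mx i n * cometric r n m = ev env (ptau i m) / (2 * r).
Proof. by rewrite sum_cometric // mxE mulfK // gdiag_neq0. Qed.

Lemma is_torsion_mx : is_torsion r (phi r h) torsion_mx.
Proof.
move=> i j k l.
have := allIP l (allIP k (allIP j (allIP i ptau_check))).
move=> /(peqP holds_unit); rewrite ev_pmul -nablaE // => nablaE'.
apply: (@mulfI _ (r ^+ 3 * 2)); first by rewrite mulf_neq0 ?expf_neq0 // pnatr_eq0.
rewrite -mulrA [LHS]nablaE' mulr_sumr; apply/esym/ev_psum => m.
rewrite torsion_mxE ev_pmul -hodge3E //; field.
by [].
Qed.

Lemma psi_norm_gt0 (n : nat) : 0 < ev env (psi_norm n).
Proof.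
have x_gt0 : 0 < r ^+ 3 by rewrite exprn_gt0.
by rewrite /psi_norm; case: ifP => _ /=; rewrite ?addr_gt0 ?mulr_gt0 // ltr0z.
Qed.

Lemma psi_contraction (m n : 'I_7) :
  \sum_(j < 7) \sum_(k < 7) \sum_(l < 7)
    ev env (get4 psi_table m j k l) * ev env (get4 psi_table n j k l)
  = (m == n)%:R * ev env (psi_norm n).
Proof.
have := allIP n (allIP m ppsi_check) => /(peqP holds_unit) psiE.
transitivity (ev env (pscale (if m == n :> nat then 1 else 0) (psi_norm n))); last first.
  by rewrite ev_pscale -val_eqE /=; case: ifP.
rewrite -psiE; apply: ev_psum => j; apply: ev_psum => k; apply: ev_psum => l.
by rewrite ev_pmul.
Qed.

(** A row of the difference, with its index raised, is annihilated by psi. Contracting once more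
    with psi over the three free indices isolates one entry times the positive [psi_norm]. *)
Lemma is_torsion_unique (T T' : 'M[R]_7) :
  is_torsion r (phi r h) T -> is_torsion r (phi r h) T' -> T = T'.
Proof.
move=> HT HT'; apply/matrixP => i n.
pose D m := (T i m - T' i m) / gdiag r m.
have D0 (j k l : 'I_7) : \sum_(m < 7) D m * ev env (get4 psi_table m j k l) = 0.
  transitivity (r ^+ 2 * (nabla r (phi r h) i j k l - nabla r (phi r h) i j k l)).
    rewrite {1}HT HT' -sumrB mulr_sumr; apply: eq_bigr => m _.
    by rewrite -hodge3E // !sum_cometric // /D; ring.
  by rewrite subrr mulr0.
have : D n = 0.
  apply: (mulIf (lt0r_neq0 (psi_norm_gt0 n))); rewrite mul0r.
  transitivity (\sum_(m < 7) \sum_(j < 7) \sum_(k < 7) \sum_(l < 7)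
      D m * ev env (get4 psi_table m j k l) * ev env (get4 psi_table n j k l)).
    have sumE m : \sum_(j < 7) \sum_(k < 7) \sum_(l < 7)
        D m * ev env (get4 psi_table m j k l) * ev env (get4 psi_table n j k l)
        = D m * ((m == n)%:R * ev env (psi_norm n)).
      rewrite -psi_contraction mulr_sumr; apply: eq_bigr => j _.
      rewrite mulr_sumr; apply: eq_bigr => k _.
      by rewrite mulr_sumr; apply: eq_bigr => l _; rewrite mulrA.
    rewrite (bigD1 n) //= sumE eqxx mul1r big1 ?addr0 // => m /negPf mn.
    by rewrite sumE mn mul0r mulr0.
  rewrite exchange_big big1 //= => j _; rewrite exchange_big big1 //= => k _.
  rewrite exchange_big big1 //= => l _.
  by rewrite -mulr_suml D0 mul0r.
move/eqP; rewrite /D mulf_eq0 invr_eq0 (negPf (gdiag_neq0 _ _)) // orbF subr_eq0.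
by move/eqP.
Qed.

(** Existence rules out the default value 0 of [xget], and uniqueness identifies the solution
    chosen. *)
Lemma torsionE : torsion r (phi r h) = torsion_mx.
Proof.
apply: is_torsion_unique is_torsion_mx.
apply: (@xgetPex _ 0 [set T | is_torsion r (phi r h) T]).
by exists torsion_mx; exact: is_torsion_mx.
Qed.

Lemma torsion_sqnormE : torsion_sqnorm r (phi r h)
  = (4 * r ^+ 6 - 14 * r ^+ 3 + 19 + 8 * (r ^+ 3 - 1) * (r ^+ 3 + 2) * q2 h ^+ 2) / r ^+ 2.
Proof.
have sqE (i j : 'I_7) :
    \sum_(a < 7) \sum_(b < 7)
      cometric r i a * cometric r j b * torsion_mx i j * torsion_mx a b
    = ev env (psqr (ptau i j)) / (2 * r) ^+ 2.
  transitivity (\sum_(a < 7) cometric r i a *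
      (torsion_mx i j * \sum_(b < 7) torsion_mx a b * cometric r b j)).
    apply: eq_bigr => a _; rewrite !mulr_sumr; apply: eq_bigr => b _.
    rewrite (cometricC r_gt0 j b); ring.
  under eq_bigr => a _ do rewrite torsion_mxE.
  transitivity (\sum_(a < 7) (torsion_mx i j * (ev env (ptau a j) / (2 * r))) * cometric r a i).
    by apply: eq_bigr => a _; rewrite mulrC (cometricC r_gt0 i a).
  rewrite sum_cometric // mxE ev_pmul.
  have := allIP j (allIP i ptau_graded); case/orP => [/eqP ij|]; last first.
    by case: (ptau i j) => //= _; rewrite !mul0r.
  have -> : gdiag r j = gdiag r i by rewrite /gdiag ij.
  field; rewrite r_neq0 gdiag_neq0 //.
rewrite /torsion_sqnorm torsionE.
under eq_bigr => i _. under eq_bigr => j _ do rewrite sqE. over.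
under eq_bigr => i _ do rewrite -mulr_suml.
rewrite -mulr_suml.
have /(peqP holds_unit) tauE := ptau_norm_check.
transitivity (ev env (psum 7 (fun i => psum 7 (fun m => psqr (ptau i m)))) / (2 * r) ^+ 2).
  by congr (_ / _); apply: ev_psum => i; apply: ev_psum.
rewrite tauE /= /zr /subr2; field.
by [].
Qed.
End Torsion.

(** * Index and nullity of quadratic forms *)

Section QuadraticForms.
Variable R : realType.
Implicit Types (u v w : 'rV[R]_3) (c : R) (U : {vspace 'rV[R]_3}).

Definition dot v w : R := (v *m w^T) 0 0.

Lemma dotE v w : dot v w = \sum_l v 0 l * w 0 l.
Proof. by rewrite /dot mxE; apply: eq_bigr => l _; rewrite mxE. Qed.

Lemma dotC v w : dot v w = dot w v.
Proof. by rewrite !dotE; apply: eq_bigr => l _; rewrite mulrC. Qed.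

Lemma dotZl c v w : dot (c *: v) w = c * dot v w.
Proof. by rewrite /dot -scalemxAl mxE. Qed.

Lemma dot_ge0 v : 0 <= dot v v.
Proof. by rewrite dotE sumr_ge0 // => l _; rewrite -expr2 sqr_ge0. Qed.

Lemma dot_eq0 v : (dot v v == 0) = (v == 0).
Proof.
apply/eqP/eqP => [|->]; last by rewrite /dot mul0mx mxE.
rewrite dotE => /eqP; rewrite psumr_eq0 => [/allP v0|l _]; last by rewrite -expr2 sqr_ge0.
apply/rowP => l; rewrite mxE; apply/eqP.
by have := v0 l (mem_index_enum _); rewrite mulf_eq0 orbb.
Qed.

Lemma dot_gt0 v : v != 0 -> 0 < dot v v.
Proof. by move=> v0; rewrite lt0r dot_eq0 v0 dot_ge0. Qed.

(** The two shapes taken by the Hessian: a multiple of the identity at [NS], rank one at [RP2]. *)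
Definition scalar_form c : 'M[R]_3 := c%:M.
Definition line_form c u : 'M[R]_3 := c *: (u^T *m u).

Lemma form_scalar c v w : Defs.form (scalar_form c) v w = c * dot v w.
Proof. by rewrite /Defs.form mul_mx_scalar -scalemxAl mxE. Qed.

Lemma form_line c u v w : Defs.form (line_form c u) v w = c * (dot v u * dot w u).
Proof.
rewrite /Defs.form /line_form -scalemxAr -scalemxAl mxE (mulmxA v) -(mulmxA (v *m u^T)).
rewrite mxE big_ord1; congr (_ * (_ * _)).
by rewrite !dotE mxE; apply: eq_bigr => l _; rewrite !mxE mulrC.
Qed.

Lemma index0_psd (B : 'M[R]_3) : (forall v, 0 <= Defs.form B v v) -> form_index B 0.
Proof.
move=> B_ge0; split=> [|U negU].
  exists 0%VS; last exact: dimv0.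
  by move=> v; rewrite memv0 => ->.
rewrite leqn0 dimv_eq0; apply/eqP/vspaceP => v; rewrite memv0.
apply/idP/idP => [vU|/eqP ->]; last exact: mem0v.
by apply/negPn/negP => /(negU v vU); rewrite ltNge B_ge0.
Qed.

Lemma index3_negdef (B : 'M[R]_3) : (forall v, v != 0 -> Defs.form B v v < 0) -> form_index B 3.
Proof.
move=> B_lt0; have dim3 : \dim {:'rV[R]_3} = 3%N by rewrite dimvf dim_matrix.
split=> [|U _]; first by exists fullv => // v _; exact: B_lt0.
by apply: leq_trans (dimvS (subvf U)) _; rewrite dim3.
Qed.

Lemma nullity_scalar c : c != 0 -> form_nullity (scalar_form c) 0.
Proof.
move=> c0; exists 0%VS; last exact: dimv0.
move=> v; rewrite memv0; split=> [/eqP -> w|v0].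
  by rewrite form_scalar /dot mul0mx mxE mulr0.
by have /eqP := v0 v; rewrite form_scalar mulf_eq0 (negPf c0) dot_eq0.
Qed.

Definition dot_fun u : 'Hom('rV[R]_3, 'M[R]_1) := linfun (mulmxr u^T).
Definition orth u : {vspace 'rV[R]_3} := lker (dot_fun u).

Lemma mem_orth u v : (v \in orth u) = (dot v u == 0).
Proof.
rewrite memv_ker lfunE /=; apply/eqP/eqP => [|vu]; first by rewrite /dot => ->; rewrite mxE.
by apply/matrixP => i j; rewrite !ord1 [RHS]mxE.
Qed.

(** Rank-nullity: the image of pairing with u is a line, being nonzero at u itself. *)
Lemma dim_orth u : u != 0 -> \dim (orth u) = 2%N.
Proof.
move=> u0; have := limg_ker_dim (dot_fun u) (fullv : {vspace 'rV[R]_3}).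
rewrite capfv -/(orth u) dimvf dim_matrix.
have dim1 : (\dim (limg (dot_fun u)) == 1)%N.
  rewrite eqn_leq; apply/andP; split.
    by apply: leq_trans (dimvS (subvf _)) _; rewrite dimvf dim_matrix.
  rewrite lt0n dimv_eq0; apply/eqP => img0.
  have : dot_fun u u \in limg (dot_fun u) by rewrite memv_img ?memvf.
  rewrite img0 memv0 lfunE /= => /eqP uu0.
  by have := dot_gt0 u0; rewrite /dot uu0 mxE ltxx.
by rewrite (eqP dim1) addn1 => -[].
Qed.

Lemma nullity_line c u : c != 0 -> u != 0 -> form_nullity (line_form c u) 2.
Proof.
move=> c0 u0; exists (orth u); last exact: dim_orth.
move=> v; rewrite mem_orth; split=> [/eqP vu w|v0].
  by rewrite form_line vu mul0r mulr0.
have /eqP := v0 u; rewrite form_line !mulf_eq0 (negPf c0) dot_eq0 (negPf u0).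
by rewrite orbF.
Qed.

(** The form vanishes on the plane [orth u], so a negative definite subspace meets it trivially and
    has dimension at most 3 - 2; the line spanned by u attains this. *)
Lemma index1_line c u : c < 0 -> u != 0 -> form_index (line_form c u) 1.
Proof.
move=> c0 u0; split=> [|U negU].
  exists <[u]>%VS; last by rewrite dim_vline u0.
  move=> v /vlineP [a ->]; rewrite scaler_eq0 negb_or => /andP[a0 _].
  rewrite form_line nmulr_rlt0 // -expr2 exprn_even_gt0 //=.
  by rewrite /dot -scalemxAl mxE mulf_neq0 // -/(dot u u) dot_eq0.
have disj : (U :&: orth u = 0)%VS.
  apply/vspaceP => v; rewrite memv_cap memv0 mem_orth.
  apply/andP/eqP => [[vU /eqP vu]|->]; last by rewrite mem0v /dot mul0mx mxE.
  apply/eqP/negPn/negP => /(negU v vU).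
  by rewrite form_line vu mul0r mulr0 ltxx.
have := dimvS (subvf (U + orth u)).
by rewrite dimv_disjoint_sum // dim_orth // dimvf dim_matrix addn2.
Qed.

End QuadraticForms.

(** * Derivative rules for functions of one variable written pointwise *)

Section Calculus.
Variable R : realType.
Implicit Types (f g : R -> R) (x d c : R).

Lemma is_derive_fD f g x df dg : is_derive x 1 f df -> is_derive x 1 g dg ->
  is_derive x 1 (fun t => f t + g t) (df + dg).
Proof. by move=> ? ?; exact: is_deriveD. Qed.

Lemma is_derive_fM f g x df dg : is_derive x 1 f df -> is_derive x 1 g dg ->
  is_derive x 1 (fun t => f t * g t) (df * g x + f x * dg).
Proof.
move=> Hf Hg; have H := is_deriveM Hf Hg; apply: is_derive_eq.
by rewrite addrC; congr (_ + _); exact: mulrC.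
Qed.

Lemma is_derive_fZ f x c d : is_derive x 1 f d -> is_derive x 1 (fun t => c * f t) (c * d).
Proof. by move=> Hf; exact: is_deriveZ. Qed.

Lemma is_derive_fcst x c : is_derive x 1 (fun=> c) (0 : R).
Proof. exact: is_derive_cst. Qed.

Lemma is_derive_unique f x d d' : is_derive x 1 f d -> is_derive x 1 f d' -> d = d'.
Proof. by move=> [_ <-] [_ <-]. Qed.

Lemma is_derive_derive1 f x : derivable f x 1 -> is_derive x 1 f (derive1 f x).
Proof. by move=> df; rewrite derive1E; exact: derivableP. Qed.

Lemma derive1_val f x d : is_derive x 1 f d -> derive1 f x = d.
Proof. by move=> Hf; rewrite derive1E derive_val. Qed.
End Calculus.

(** * Energy, critical points and Hessian *)

Definition pround (i j : nat) : pexpr :=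
  let dotq x y := padd (padd (padd (pmul (p0 x) (p0 y)) (pmul (p1 x) (p1 y)))
    (pmul (p2 x) (p2 y))) (pmul (p3 x) (p3 y)) in
  padd (dotq (pbasis i 0 1) (pbasis j 0 1)) (dotq (pbasis i 1 1) (pbasis j 1 1)).

Lemma pround_check : allI 7 (fun i => allI 7 (fun j =>
  peq sqrt_hyp (pscale 2 (pround i j))
    (Pc (if i == j then if (i < 3)%N then 2 else 1 else 0)))).
Proof. by vm_compute. Qed.

Section Volume.
Variables (R : realType) (r : R).
Hypothesis r_gt0 : 0 < r.
Let env : seq R := [:: (Num.sqrt 2)^-1].

Lemma round_metricE :
  round_metric R = diag_mx (\row_i if (i < 3)%N then 1 else 2^-1).
Proof.
apply/matrixP => i j; apply: (@mulfI _ 2); first by rewrite pnatr_eq0.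
have := allIP j (allIP i pround_check) => /(peqP (holds_sqrt R)); rewrite ev_pscale => roundE.
have dotE (x y : quat R) :
    q0 (qconj x * y) = q0 x * q0 y + q1 x * q1 y + q2 x * q2 y + q3 x * q3 y.
  by case: x => ? ? ? ?; case: y => ? ? ? ? /=; ring.
transitivity (2%:~R * ev env (pround i j)).
  congr (_ * _); rewrite mxE !big_ord_recl big_ord0 addr0 !dotE !ebasisE.
  by rewrite /pround !(ev_padd, ev_pmul).
rewrite [LHS]roundE !mxE -val_eqE /= /zr.
case: eqP => _; rewrite ?mulr0 //; case: ifP => _; rewrite ?mulr1 // mulr1n mulfV //.
Qed.

(** Makes the energy a positive multiple of |T|^2, with the same critical points and minima. *)
Lemma volume_gt0 : 0 < volume r.
Proof.
rewrite /volume mulr_gt0 ?divr_gt0 ?exprn_gt0 ?pi_gt0 ?ltr0n //.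
rewrite sqrtr_gt0 divr_gt0 ?det_metric ?exprn_gt0 //.
rewrite round_metricE det_diag prodr_gt0 // => i _; rewrite mxE.
by case: ifP; rewrite ?invr_gt0 ?ltr0n.
Qed.
End Volume.

Section Energy.
Variables (R : realType) (r : R).
Hypothesis r_gt0 : 0 < r.
Implicit Types (h : quat R) (c : R -> quat R).

(** Euler's four-square identity. *)
Lemma unitqM (x y : quat R) : unitq x -> unitq y -> unitq (x * y).
Proof.
move=> xu yu; rewrite /unitq -[1]mulr1 -{1}xu -yu.
by case: x {xu} => ? ? ? ?; case: y {yu} => ? ? ? ? /=; ring.
Qed.

Lemma unitq_le1 h : unitq h -> q2 h ^+ 2 <= 1.
Proof.
move=> <-; have := sqr_ge0 (q0 h); have := sqr_ge0 (q1 h); have := sqr_ge0 (q3 h); lra.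
Qed.

Definition quad_coef : R := 8 * (r ^+ 3 - 1) * (r ^+ 3 + 2) / r ^+ 2.
Definition const_coef : R := (4 * r ^+ 6 - 14 * r ^+ 3 + 19) / r ^+ 2.

Lemma torsion_sqnorm_quad h : unitq h ->
  torsion_sqnorm r (phi r h) = const_coef + quad_coef * q2 h ^+ 2.
Proof.
by move=> hu; rewrite torsion_sqnormE // /const_coef /quad_coef; field; rewrite gt_eqF.
Qed.

(** Isolates r^3 - 1, the one factor whose sign varies. *)
Lemma quad_coefE : quad_coef = 8 * (r ^+ 3 + 2) / r ^+ 2 * (r ^+ 3 - 1).
Proof. by rewrite /quad_coef; ring. Qed.

Lemma quad_factor_gt0 : 0 < 8 * (r ^+ 3 + 2) / r ^+ 2.
Proof. by rewrite divr_gt0 ?mulr_gt0 ?addr_gt0 ?exprn_gt0. Qed.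

Lemma quad_coef_gt0 : 1 < r -> 0 < quad_coef.
Proof.
by move=> r1; rewrite quad_coefE pmulr_rgt0 ?quad_factor_gt0 // subr_gt0 exprn_egt1.
Qed.

Lemma quad_coef_lt0 : r < 1 -> quad_coef < 0.
Proof.
move=> r1; rewrite quad_coefE pmulr_rlt0 ?quad_factor_gt0 // subr_lt0.
by rewrite exprn_ilt1 // ltW.
Qed.

Lemma quad_coef_eq0 : r = 1 -> quad_coef = 0.
Proof. by rewrite quad_coefE => ->; rewrite expr1n subrr mulr0. Qed.

Lemma Ered_quad h : unitq h ->
  Ered r h = 2^-1 * volume r * (const_coef + quad_coef * q2 h ^+ 2).
Proof. by move=> hu; rewrite /Ered /energy torsion_sqnorm_quad //; ring. Qed.

Lemma is_derive_Ered c (d : R) : (forall t, unitq (c t)) ->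
  is_derive (0 : R) 1 (fun t => q2 (c t)) d ->
  is_derive (0 : R) 1 (fun t => Ered r (c t))
    (volume r * quad_coef * (q2 (c 0) * d)).
Proof.
move=> cu c2; have -> : (fun t => Ered r (c t))
    = (fun t => 2^-1 * volume r * (const_coef + quad_coef * (q2 (c t) * q2 (c t)))).
  by apply/funext => t; rewrite Ered_quad // expr2.
have H := is_derive_fZ (2^-1 * volume r) (is_derive_fD (is_derive_fcst 0 const_coef)
  (is_derive_fZ quad_coef (is_derive_fM c2 c2))).
by apply: is_derive_eq; field.
Qed.

Lemma unit_curve_orth (a0 a1 a2 a3 : R -> R) (x d0 d1 d2 d3 : R) :
  (forall t, a0 t ^+ 2 + a1 t ^+ 2 + a2 t ^+ 2 + a3 t ^+ 2 = 1) ->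
  is_derive x 1 a0 d0 -> is_derive x 1 a1 d1 ->
  is_derive x 1 a2 d2 -> is_derive x 1 a3 d3 ->
  a0 x * d0 + a1 x * d1 + a2 x * d2 + a3 x * d3 = 0.
Proof.
move=> a_unit H0 H1 H2 H3.
have H := is_derive_fD (is_derive_fD (is_derive_fD (is_derive_fM H0 H0) (is_derive_fM H1 H1))
  (is_derive_fM H2 H2)) (is_derive_fM H3 H3).
have E : (fun t => a0 t * a0 t + a1 t * a1 t + a2 t * a2 t + a3 t * a3 t) = (fun=> 1).
  by apply/funext => t; rewrite -!expr2.
rewrite E in H; have := is_derive_unique H (is_derive_fcst x 1); lra.
Qed.

Lemma criticalP h : quad_coef != 0 -> critical r h <-> NS h \/ RP2 h.
Proof.
move=> C0.
have V0 : volume r != 0 by rewrite gt_eqF // volume_gt0.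
split=> [[hu hc]|].
  (* The energy is differentiated along the great circle exp(t u) h, for u = u1 i + u2 j + u3 k of
     norm one; the factor in parentheses is the j-coordinate of the velocity u h. *)
  have step (u1 u2 u3 : R) : u1 ^+ 2 + u2 ^+ 2 + u3 ^+ 2 = 1 ->
      q2 h * (u2 * q0 h + u3 * q1 h - u1 * q3 h) = 0.
    move=> uu; pose g : quat R := Quat 0 u1 u2 u3 * h.
    pose rot (a b t : R) := cos t * a + sin t * b.
    pose c t := Quat (rot (q0 h) (q0 g) t) (rot (q1 h) (q1 g) t)
                     (rot (q2 h) (q2 g) t) (rot (q3 h) (q3 g) t).
    have rotD a b : is_derive (0 : R) 1 (rot a b) b.
      have := is_derive_fD (is_derive_fM (is_derive_cos 0) (is_derive_fcst 0 a))
        (is_derive_fM (is_derive_sin 0) (is_derive_fcst 0 b)).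
      by move=> H; apply: is_derive_eq; rewrite sin0 cos0; ring.
    have cu t : unitq (c t).
      have -> : c t = Quat (cos t) (sin t * u1) (sin t * u2) (sin t * u3) * h.
        by apply: quat_ext; rewrite /c /rot /=; ring.
      apply: unitqM => //; rewrite /unitq /= -(cos2Dsin2 t).
      by rewrite -[X in _ = _ + X]mulr1 -uu; ring.
    have c0 : c 0 = h by apply: quat_ext; rewrite /c /rot /= cos0 sin0; ring.
    have rotd a b : derivable (rot a b) (0 : R) 1 by case: (rotD a b).
    have H := hc c cu c0 (rotd _ _) (rotd _ _) (rotd _ _) (rotd _ _).
    have := is_derive_unique H (is_derive_Ered cu (rotD _ _)).
    move/esym/eqP; rewrite c0 mulf_eq0 (negPf (mulf_neq0 V0 C0)) /= => /eqP.
    by move=> <-; rewrite /g /=; ring.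
  (* When [q2 h] is nonzero, the directions i, j and k force h_3, h_0 and h_1 to vanish. *)
  have s1 := step 1 0 0; have s2 := step 0 1 0; have s3 := step 0 0 1.
  case: (eqVneq (q2 h) 0) => [h2|h2]; [by right|left].
  have hz x : q2 h * x = 0 -> x = 0 by move/eqP; rewrite mulf_eq0 (negPf h2) => /eqP.
  have h3 : q3 h = 0.
    have := hz _ (s1 _); rewrite !mul0r !mul1r => h3; apply/eqP; rewrite -oppr_eq0; apply/eqP.
    by rewrite -[RHS]h3; ring.
  have h0 : q0 h = 0.
    have := hz _ (s2 _); rewrite !mul0r !mul1r => h0; rewrite -[RHS]h0; ring.
  have h1 : q1 h = 0.
    have := hz _ (s3 _); rewrite !mul0r !mul1r => h1; rewrite -[RHS]h1; ring.
  move: hu; rewrite /unitq h0 h1 h3 => hu.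
  have /eqP : q2 h ^+ 2 = 1 by rewrite -hu; ring.
  rewrite sqrf_eq1 /NS => /orP[] /eqP h2E; [left|right]; exact: quat_ext.
move=> hh; have hu : unitq h.
  by case: hh => [[->|->]|[]//]; rewrite /unitq /=; ring.
split; first exact: hu.
move=> c cu c0 D0 D1 D2 D3.
have := is_derive_Ered cu (is_derive_derive1 D2); rewrite c0.
suff -> : q2 h * derive1 (fun t => q2 (c t)) 0 = 0 by rewrite mulr0.
(* On [RP2] the factor [q2 h] is 0; at [NS], h is j or -j, and a vector tangent to the sphere there
   has no j-coordinate. *)
case: hh => [hNS|[_ ->]]; last by rewrite mul0r.
have := unit_curve_orth cu (is_derive_derive1 D0) (is_derive_derive1 D1)
  (is_derive_derive1 D2) (is_derive_derive1 D3).
by rewrite c0; case: hNS => -> /= E; rewrite -[RHS]E; ring.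
Qed.

End Energy.

(** * Second variation of |T|^2 *)

Section Hessian.
Variables (R : realType) (r : R) (h : quat R).
Hypotheses (r_gt0 : 0 < r) (h_unit : unitq h).

Let r_neq0 : r != 0. Proof. by rewrite gt_eqF. Qed.

Lemma smooth2_derivs (f : R -> R -> R) : smooth2 f ->
  [/\ forall s, derivable (fun t => f t s) (0 : R) 1,
      derivable (fun s => f 0 s) (0 : R) 1 &
      derivable (fun s => derive1 (fun t => f t s) 0) (0 : R) 1].
Proof. by move=> /(_ 2) [_ [Dt Ds [_ [_ Dts _ _]] _]]; split. Qed.

(* The third coordinate of x * h. *)
Definition mul_q2 (x : quat R) : R :=
  q0 x * q2 h - q1 x * q3 h + q2 x * q0 h + q3 x * q1 h.

Lemma is_derive_mul_q2 (c : R -> quat R) (x : R) (d : quat R) :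
  is_derive x 1 (fun t => q0 (c t)) (q0 d) -> is_derive x 1 (fun t => q1 (c t)) (q1 d) ->
  is_derive x 1 (fun t => q2 (c t)) (q2 d) -> is_derive x 1 (fun t => q3 (c t)) (q3 d) ->
  is_derive x 1 (fun t => mul_q2 (c t)) (mul_q2 d).
Proof.
move=> H0 H1 H2 H3.
have H := is_derive_fD (is_derive_fD (is_derive_fD (is_derive_fZ (q2 h) H0)
  (is_derive_fZ (- q3 h) H1)) (is_derive_fZ (q0 h) H2)) (is_derive_fZ (q1 h) H3).
have -> : (fun t => mul_q2 (c t)) = (fun t => q2 h * q0 (c t) + - q3 h * q1 (c t)
    + q0 h * q2 (c t) + q1 h * q3 (c t)).
  by apply/funext => t; rewrite /mul_q2; ring.
by apply: is_derive_eq; rewrite /mul_q2; ring.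
Qed.

Definition imrow (x : quat R) : 'rV[R]_3 := \row_l qim l x.

Lemma dot_imrow x y : dot (imrow x) (imrow y) = q1 x * q1 y + q2 x * q2 y + q3 x * q3 y.
Proof. by rewrite dotE !big_ord_recl big_ord0 !mxE addr0 addrA. Qed.

Section Variation.
Variable k : R -> R -> quat R.
Hypothesis k_var : Defs.variation k.

Definition dt_quat (s : R) : quat R :=
  Quat (derive1 (fun t => q0 (k t s)) 0) (derive1 (fun t => q1 (k t s)) 0)
       (derive1 (fun t => q2 (k t s)) 0) (derive1 (fun t => q3 (k t s)) 0).
Definition ds_quat : quat R :=
  Quat (derive1 (fun s => q0 (k 0 s)) 0) (derive1 (fun s => q1 (k 0 s)) 0)
       (derive1 (fun s => q2 (k 0 s)) 0) (derive1 (fun s => q3 (k 0 s)) 0).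
Definition dts_quat : quat R :=
  Quat (derive1 (fun s => q0 (dt_quat s)) 0) (derive1 (fun s => q1 (dt_quat s)) 0)
       (derive1 (fun s => q2 (dt_quat s)) 0) (derive1 (fun s => q3 (dt_quat s)) 0).

Lemma variation_smooth : [/\ smooth2 (fun t s => q0 (k t s)), smooth2 (fun t s => q1 (k t s)),
  smooth2 (fun t s => q2 (k t s)) & smooth2 (fun t s => q3 (k t s))].
Proof.
case: k_var => _ _ k0 kl; split; first exact: k0.
- exact: (kl (@Ordinal 3 0 isT)).
- exact: (kl (@Ordinal 3 1 isT)).
- exact: (kl (@Ordinal 3 2 isT)).
Qed.

(** [mul_q2] is linear, so this is the product rule for its square. The last term involves second
    derivatives of k; at a critical point it must reduce to V and W. *)
Lemma hessian_value :
  derive1 (fun s => derive1 (fun t => torsion_sqnorm r (phi r (k t s * h))) 0) 0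
  = 2 * quad_coef r * (mul_q2 ds_quat * mul_q2 (dt_quat 0) + q2 h * mul_q2 dts_quat).
Proof.
case: k_var => ku k1 _ _.
have [/smooth2_derivs[Dt0 Ds0 Dts0] /smooth2_derivs[Dt1 Ds1 Dts1]
  /smooth2_derivs[Dt2 Ds2 Dts2] /smooth2_derivs[Dt3 Ds3 Dts3]] := variation_smooth.
have sqE t s : torsion_sqnorm r (phi r (k t s * h))
    = const_coef r + quad_coef r * (mul_q2 (k t s) * mul_q2 (k t s)).
  by rewrite torsion_sqnorm_quad //; exact: unitqM.
have Ht s : is_derive (0 : R) 1 (fun t => mul_q2 (k t s)) (mul_q2 (dt_quat s)).
  exact: (@is_derive_mul_q2 (fun t => k t s) 0 (dt_quat s) (is_derive_derive1 (Dt0 s))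
    (is_derive_derive1 (Dt1 s)) (is_derive_derive1 (Dt2 s)) (is_derive_derive1 (Dt3 s))).
have Hs : is_derive (0 : R) 1 (fun s => mul_q2 (k 0 s)) (mul_q2 ds_quat).
  exact: (@is_derive_mul_q2 (fun s => k 0 s) 0 ds_quat (is_derive_derive1 Ds0)
    (is_derive_derive1 Ds1) (is_derive_derive1 Ds2) (is_derive_derive1 Ds3)).
have Hts : is_derive (0 : R) 1 (fun s => mul_q2 (dt_quat s)) (mul_q2 dts_quat).
  exact: (@is_derive_mul_q2 dt_quat 0 dts_quat (is_derive_derive1 Dts0)
    (is_derive_derive1 Dts1) (is_derive_derive1 Dts2) (is_derive_derive1 Dts3)).
have inner s : derive1 (fun t => torsion_sqnorm r (phi r (k t s * h))) 0
    = 2 * quad_coef r * (mul_q2 (k 0 s) * mul_q2 (dt_quat s)).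
  under eq_fun => t do rewrite sqE.
  rewrite (derive1_val (is_derive_fD (is_derive_fcst 0 (const_coef r))
    (is_derive_fZ (quad_coef r) (is_derive_fM (Ht s) (Ht s))))); ring.
under eq_fun => s do rewrite inner.
rewrite (derive1_val (is_derive_fZ (2 * quad_coef r) (is_derive_fM Hs Hts))).
rewrite k1 (_ : mul_q2 1 = q2 h); first reflexivity.
by rewrite /mul_q2 /=; ring.
Qed.

Lemma k_tangent s : q0 (k 0 s) * q0 (dt_quat s) + q1 (k 0 s) * q1 (dt_quat s)
  + q2 (k 0 s) * q2 (dt_quat s) + q3 (k 0 s) * q3 (dt_quat s) = 0.
Proof.
case: k_var => ku _ _ _.
have [/smooth2_derivs[Dt0 _ _] /smooth2_derivs[Dt1 _ _]
  /smooth2_derivs[Dt2 _ _] /smooth2_derivs[Dt3 _ _]] := variation_smooth.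
exact: (unit_curve_orth (fun t => ku t s) (is_derive_derive1 (Dt0 s))
  (is_derive_derive1 (Dt1 s)) (is_derive_derive1 (Dt2 s)) (is_derive_derive1 (Dt3 s))).
Qed.

Lemma dt_quat_q0 : q0 (dt_quat 0) = 0.
Proof.
case: k_var => _ k1 _ _; have := k_tangent 0; rewrite k1 /= => E.
by rewrite -[RHS]E; ring.
Qed.

(** The s-derivative of [k_tangent] at k = 1: the unit constraint expresses the real part of the
    second derivative through the first derivatives. *)
Lemma dts_quat_q0 : q0 dts_quat = - (q1 (dt_quat 0) * q1 ds_quat
  + q2 (dt_quat 0) * q2 ds_quat + q3 (dt_quat 0) * q3 ds_quat).
Proof.
case: k_var => ku k1 _ _.
have [/smooth2_derivs[Dt0 Ds0 Dts0] /smooth2_derivs[Dt1 Ds1 Dts1]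
  /smooth2_derivs[Dt2 Ds2 Dts2] /smooth2_derivs[Dt3 Ds3 Dts3]] := variation_smooth.
have D0 : is_derive (0 : R) 1 (fun s => q0 (k 0 s)) (q0 ds_quat) := is_derive_derive1 Ds0.
have D1 : is_derive (0 : R) 1 (fun s => q1 (k 0 s)) (q1 ds_quat) := is_derive_derive1 Ds1.
have D2 : is_derive (0 : R) 1 (fun s => q2 (k 0 s)) (q2 ds_quat) := is_derive_derive1 Ds2.
have D3 : is_derive (0 : R) 1 (fun s => q3 (k 0 s)) (q3 ds_quat) := is_derive_derive1 Ds3.
have E0 : is_derive (0 : R) 1 (fun s => q0 (dt_quat s)) (q0 dts_quat) := is_derive_derive1 Dts0.
have E1 : is_derive (0 : R) 1 (fun s => q1 (dt_quat s)) (q1 dts_quat) := is_derive_derive1 Dts1.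
have E2 : is_derive (0 : R) 1 (fun s => q2 (dt_quat s)) (q2 dts_quat) := is_derive_derive1 Dts2.
have E3 : is_derive (0 : R) 1 (fun s => q3 (dt_quat s)) (q3 dts_quat) := is_derive_derive1 Dts3.
have := is_derive_fD (is_derive_fD (is_derive_fD (is_derive_fM D0 E0) (is_derive_fM D1 E1))
  (is_derive_fM D2 E2)) (is_derive_fM D3 E3).
have -> : (fun s => q0 (k 0 s) * q0 (dt_quat s) + q1 (k 0 s) * q1 (dt_quat s)
    + q2 (k 0 s) * q2 (dt_quat s) + q3 (k 0 s) * q3 (dt_quat s)) = fun=> 0.
  exact/funext/k_tangent.
move=> H; have := is_derive_unique H (is_derive_fcst 0 0).
have [q01 q11 q21 q31] :
  [/\ q0 1 = 1 :> R, q1 1 = 0 :> R, q2 1 = 0 :> R & q3 1 = 0 :> R] by [].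
rewrite k1 dt_quat_q0 q01 q11 q21 q31.
move: (ds_quat) (dts_quat) (dt_quat 0) => ds dts dt {H} E; lra.
Qed.

Lemma dt_row (a : R) :
  \row_l (a * derive1 (fun t => qim l (k t 0)) 0) = a *: imrow (dt_quat 0).
Proof. by apply/rowP => -[[|[|[|//]]] ?]; rewrite !mxE. Qed.

Lemma ds_row (a : R) :
  \row_l (a * derive1 (fun s => qim l (k 0 s)) 0) = a *: imrow ds_quat.
Proof. by apply/rowP => -[[|[|[|//]]] ?]; rewrite !mxE. Qed.
End Variation.

(** The second-derivative term carries the factor [q2 h] = 0, and the row (-h_3, h_0, h_1)
    represents [mul_q2] on imaginary quaternions. The scale r^2 / 4 undoes the two factors 2 / r in
    V and W. *)
Lemma is_hessian_RP2 : q2 h = 0 ->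
  is_hessian r h (line_form (quad_coef r * r ^+ 2 / 2)
    (imrow (Quat 0 (- q3 h) (q0 h) (q1 h)))).
Proof.
move=> h2; split=> [|k k_var].
  by rewrite /line_form linearZ /= trmx_mul trmxK.
have dotgE x : dot (imrow x) (imrow (Quat 0 (- q3 h) (q0 h) (q1 h))) = mul_q2 x.
  by rewrite dot_imrow /mul_q2 h2 /=; ring.
cbv zeta; rewrite (hessian_value k_var) h2 mul0r addr0 dt_row ds_row form_line.
move: (dt_quat k 0) (ds_quat k) => dt ds.
by rewrite !dotZl !dotgE; field; exact: r_neq0.
Qed.

(** Here [mul_q2] reads off the real part up to sign, so the first-derivative product vanishes and
    [dts_quat_q0] turns the remaining term into minus the dot product. *)
Lemma is_hessian_NS : NS h -> is_hessian r h (scalar_form (- (quad_coef r * r ^+ 2 / 2))).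
Proof.
move=> hNS; split=> [|k k_var]; first exact: tr_scalar_mx.
have h2 : q2 h ^+ 2 = 1 by case: hNS => -> /=; ring.
have mulE x : mul_q2 x = q2 h * q0 x by rewrite /mul_q2; case: hNS => -> /=; ring.
cbv zeta; rewrite (hessian_value k_var) dt_row ds_row.
have := dt_quat_q0 k_var; have := dts_quat_q0 k_var.
move: (dt_quat k 0) (ds_quat k) (dts_quat k) => dt ds dts dtsE dtE.
rewrite form_scalar !mulE dtsE dtE dotZl dotC dotZl dot_imrow.
rewrite !mulr0 add0r (mulrA (q2 h)) -expr2 h2.
by field; exact: r_neq0.
Qed.

Lemma is_hessian_flat : quad_coef r = 0 -> is_hessian r h (scalar_form 0).
Proof.
move=> C0; split=> [|k k_var]; first exact: tr_scalar_mx.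
by cbv zeta; rewrite form_scalar mul0r (hessian_value k_var) C0 mulr0 mul0r.
Qed.
End Hessian.

(** * Index, nullity and stability from the sign of [quad_coef] *)

Theorem theorem4 (R : realType) (r : R) (hr : 0 < r) :
  (r != 1 -> forall h : quat R, critical r h <-> NS h \/ RP2 h) /\
  (r < 1 ->
     (forall h : quat R, NS h ->
        reduced_index r h 0 /\ reduced_nullity r h 0 /\
        stable r h /\ local_min r h) /\
     (forall h : quat R, RP2 h ->
        reduced_index r h 1 /\ reduced_nullity r h 2 /\ unstable r h)) /\
  (1 < r ->
     (forall h : quat R, NS h ->
        reduced_index r h 3 /\ reduced_nullity r h 0 /\ unstable r h) /\
     (forall h : quat R, RP2 h ->
        reduced_index r h 0 /\ reduced_nullity r h 2 /\
        stable r h /\ local_min r h)) /\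
  (r = 1 ->
     (forall h h' : quat R, unitq h -> unitq h' -> Ered r h = Ered r h') /\
     (forall h : quat R, unitq h -> stable r h)).
Proof.
have NS_unit h : NS h -> unitq h /\ q2 h ^+ 2 = 1 :> R.
  by case=> ->; rewrite /unitq /=; split; ring.
have scale_gt0 : 0 < r ^+ 2 / 2 by rewrite divr_gt0 ?exprn_gt0.
have coefE : quad_coef r * r ^+ 2 / 2 = quad_coef r * (r ^+ 2 / 2) by rewrite mulrA.
have scalar_formE (c : R) v : Defs.form (scalar_form c) v v = c * dot v v by exact: form_scalar.
have u_neq0 h : RP2 h -> imrow (Quat 0 (- q3 h) (q0 h) (q1 h)) != 0 :> 'rV[R]_3.
  move=> [hu h2]; rewrite -dot_eq0 dot_imrow /= (_ : _ + _ = 1) ?oner_eq0 //.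
  by move: hu; rewrite /unitq h2 => <-; ring.
have criticalE h : quad_coef r != 0 -> NS h \/ RP2 h -> critical r h.
  by move=> C0; have [] := criticalP hr h C0.
have local_minE h : unitq h ->
    (forall h', unitq h' -> quad_coef r * q2 h ^+ 2 <= quad_coef r * q2 h' ^+ 2) ->
    local_min r h.
  (* The minimum is global on the sphere, so any radius serves. *)
  move=> hu hmin; exists 1 => // h' h'u _ _ _ _.
  rewrite !Ered_quad // ler_pM2l; first by rewrite lerD2l; exact: hmin.
  by rewrite mulr_gt0 ?volume_gt0 // invr_gt0.
split.
  move=> r1 h; apply: criticalP => //.
  move: r1; rewrite neq_lt => /orP[/(quad_coef_lt0 hr)|/(quad_coef_gt0 hr)] C0.
    by rewrite lt_eqF.
  by rewrite gt_eqF.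
split.
  move=> /(quad_coef_lt0 hr) C0; have C_neq0 : quad_coef r != 0 by rewrite lt_eqF.
  have c_lt0 : quad_coef r * r ^+ 2 / 2 < 0 by rewrite coefE pmulr_llt0.
  split=> h hh.
    have [hu h2] := NS_unit h hh; have hess := is_hessian_NS hr hu hh.
    have ind : reduced_index r h 0.
      exists (scalar_form (- (quad_coef r * r ^+ 2 / 2))) => //; apply: index0_psd => v.
      by rewrite scalar_formE mulr_ge0 ?dot_ge0 // oppr_ge0 ltW.
    split; [exact: ind|split; [|split]].
    - exists (scalar_form (- (quad_coef r * r ^+ 2 / 2))) => //.
      by apply: nullity_scalar; rewrite oppr_eq0 lt_eqF.
    - by split; [apply: criticalE; [|left]|exact: ind].
    (* With a negative coefficient the energy is least where h_2^2 attains its maximum 1. *)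
    - apply: local_minE => // h' h'u; rewrite h2 ler_nM2l //; exact: unitq_le1.
  have [hu h2] := hh; have hess := is_hessian_RP2 hr hu h2.
  have ind : reduced_index r h 1.
    by eexists; [exact: hess|apply: index1_line => //; exact: u_neq0].
  split; first exact: ind.
  split.
    by eexists; [exact: hess|apply: nullity_line; [rewrite lt_eqF|exact: u_neq0]].
  by split; [apply: criticalE; [|right]|exists 1%N].
split.
  move=> /(quad_coef_gt0 hr) C0; have C_neq0 : quad_coef r != 0 by rewrite gt_eqF.
  have c_gt0 : 0 < quad_coef r * r ^+ 2 / 2 by rewrite coefE mulr_gt0.
  split=> h hh.
    have [hu h2] := NS_unit h hh; have hess := is_hessian_NS hr hu hh.
    have ind : reduced_index r h 3.
      exists (scalar_form (- (quad_coef r * r ^+ 2 / 2))) => //; apply: index3_negdef => v v0.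
      by rewrite scalar_formE mulNr oppr_lt0 mulr_gt0 ?dot_gt0.
    split; first exact: ind.
    split.
      exists (scalar_form (- (quad_coef r * r ^+ 2 / 2))) => //.
      by apply: nullity_scalar; rewrite oppr_eq0 gt_eqF.
    by split; [apply: criticalE; [|left]|exists 3%N].
  have [hu h2] := hh; have hess := is_hessian_RP2 hr hu h2.
  have ind : reduced_index r h 0.
    eexists; [exact: hess|apply: index0_psd => v].
    by rewrite form_line mulr_ge0 ?(ltW c_gt0) // -expr2 sqr_ge0.
  split; first exact: ind.
  split.
    by eexists; [exact: hess|apply: nullity_line; [rewrite gt_eqF|exact: u_neq0]].
  split; first by split; [apply: criticalE; [|right]|exact: ind].
  by apply: local_minE => // h' h'u; rewrite h2 expr0n mulr0 mulr_ge0 ?sqr_ge0 // ltW.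
move=> /(quad_coef_eq0) C0; have Econst h h' : unitq h -> unitq h' -> Ered r h = Ered r h'.
  by move=> hu h'u; rewrite !Ered_quad // C0 !mul0r.
split; first exact: Econst.
move=> h hu; split.
  split; first exact: hu.
  move=> c cu _ _ _ _ _.
  (* Criticality comes from constancy, since [criticalP] assumes a nonzero coefficient. *)
  have -> : (fun t => Ered r (c t)) = (fun=> Ered r h).
    by apply/funext => t; apply: Econst; [exact: cu|exact: hu].
  exact: is_derive_fcst.
exists (scalar_form 0); first exact: is_hessian_flat.
by apply: index0_psd => v; rewrite scalar_formE mul0r.
Qed.
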